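(* Let $k\in\mathbb{N}$. For every complex number $s=\sigma+it\neq 1$ with $\sigma>1/2$, $$\zeta^k(s)=\sum_{n\ge -k}(-1)^n\,\ell_{n,k}\left(\frac{s-1}{s}\right)^n,$$ where the series converges absolutely, and $$\ell_{n,k}=\begin{cases}(-1)^n\displaystyle\sum_{j=1}^n\binom{n-1}{j-1}\frac{\lambda_{j+k,k}}{(j+k)!}, & n\ge 1,\\[2mm] (-1)^k\displaystyle\sum_{j=0}^{k+n}\binom{k-j}{-n}(-1)^j\frac{\lambda_{j,k}}{j!}, & -k\le n\le 0.\end{cases}$$
   Context: $\zeta$ denotes the Riemann zeta function. For $k\in\mathbb{N}$, the numbers $\lambda_{j,k}$ ($j\in\mathbb{N}_0$) are the Taylor coefficients of the entire-near-$1$ function $(s-1)^k\zeta^k(s)$ at $s=1$: for $|s-1|\le 1$, $(s-1)^k\zeta^k(s)=\sum_{j\ge0}\frac{\lambda_{j,k}}{j!}(s-1)^j$. Binomial coefficients $\binom{a}{b}=a!/(b!(a-b)!)$ for $0\le b\le a$ integers and $0$ otherwise. *)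

(* Defs.v *)
From mathcomp Require Import all_boot all_order all_algebra.
From mathcomp Require Import all_classical all_reals all_analysis.
From mathcomp Require Import complex.
Set Implicit Arguments. Unset Strict Implicit. Unset Printing Implicit Defensive.
Import Order.TTheory GRing.Theory Num.Theory.
Import numFieldNormedType.Exports.
Local Open Scope ring_scope.
Local Open Scope complex_scope.

(* The complex numbers, seen as a numFieldType (hence a normed field, with
   the complex topology, so that derive1 is the complex derivative). *)
Definition C (R : realType) : numFieldType := R[i].

(* a^z := exp (z * ln a) for a real a > 0 and complex z
   (= e^{Re z ln a} (cos (Im z ln a) + i sin (Im z ln a))). *)
Definition cpow (R : realType) (a : R) (z : C R) : C R :=
  let: x +i* y := (z : R[i]) in
  (expR (x * ln a) * cos (y * ln a)) +i* (expR (x * ln a) * sin (y * ln a)).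

(* Riemann zeta function, via its standard analytic continuation to Re s > 0,
   s <> 1:  zeta s = lim_{N -> oo} ( sum_{n=1}^N n^{-s} - N^{1-s}/(1-s) ).
   (For Re s > 1 this is the Dirichlet series sum_{n>=1} n^{-s}.) *)
Definition zeta (R : realType) (s : C R) : C R :=
  limn (fun N : nat =>
    \sum_(1 <= n < N.+1) cpow (n%:R) (- s) - cpow (N%:R) (1 - s) / (1 - s)).

(* (s-1)^k zeta^k(s), extended by its limit value 1 at s = 1
   (the residue of zeta at 1 is 1). *)
Definition zetak_reg (R : realType) (k : nat) (s : C R) : C R :=
  if s == 1 then 1 else ((s - 1) * zeta s) ^+ k.

(* lambda_{j,k}: j-th derivative at s = 1 of (s-1)^k zeta^k(s), so that
   (s-1)^k zeta^k(s) = sum_j lambda_{j,k}/j! (s-1)^j. *)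
Definition lambda (R : realType) (j k : nat) : C R :=
  derive1n j (@zetak_reg R k) 1.

(* ell_{n,k} for integers n (the formula for n <= 0 is meant for -k <= n <= 0,
   where k + n = k - |n|). *)
Definition ell (R : realType) (n : int) (k : nat) : C R :=
  if (0 < n)%R then
    (-1) ^+ `|n|%N *
      \sum_(1 <= j < `|n|%N.+1)
        'C(`|n|%N.-1, j.-1)%:R * lambda R (j + k) k / (j + k)`!%:R
  else
    (-1) ^+ k *
      \sum_(0 <= j < (k - `|n|%N).+1)
        'C(k - j, `|n|%N)%:R * (-1) ^+ j * lambda R j k / j`!%:R.

(* Main.v *)
Require Import Defs.
From mathcomp Require Import all_boot all_order all_algebra.
From mathcomp Require Import cyclic separable cyclotomic.
From mathcomp Require Import all_classical all_reals all_analysis.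
From mathcomp Require Import complex.
From mathcomp Require Import ring lra zify.
Import Order.TTheory GRing.Theory Num.Theory.
Import numFieldNormedType.Exports.
Set Implicit Arguments.
Unset Strict Implicit.
Unset Printing Implicit Defensive.
Local Open Scope ring_scope.
Local Open Scope complex_scope.

(* In the variable z = (s - 1) / s the half-plane Re s > 1/2 is the unit disc,
   and ((1 - z)^-1 - 1) = s - 1, so it suffices that
   (1 - z)^k ((s - 1) zeta s)^k is the sum of its power series in the whole
   disc |z| < 1, and to read off its coefficients from the Taylor coefficients
   of ((s - 1) zeta s)^k at 1, using the expansions of z^j (1 - z)^(k - j).

   Analyticity on a disc is expressed as uniform approximability by polynomials
   on smaller discs. Averaging a polynomial over roots of unity gives Cauchy's
   estimate without integrals; hence the coefficients, and the derivatives, of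
   the approximating polynomials converge, and the limit is the sum of its
   Taylor series on the whole disc. This class is closed under sums, products,
   composition and uniform limits. It contains the exponential, because of
   (1 + z / n)^n, hence the functions
   (s - 1) sum_(n <= N) n^-s + N^(1 - s) of z, whose consecutive differences are
   O(N^(-3/2)) locally uniformly for Re s >= 1/2. *)


(** * Real-valued modulus and completeness of the complex numbers *)

Section ComplexNorm.
Variable R : realType.
Implicit Types (z w : C R) (x : R).

(* The norm of a numFieldType takes its values in the field itself; [cn] is
   the real-valued one. *)
Definition cn z : R := Normc.normc (z : R[i]).

Lemma norm_cn z : `|z| = (cn z)%:C.
Proof. by []. Qed.

Lemma cn_ge0 z : 0 <= cn z.
Proof. by rewrite /cn; case: z => a b /=; rewrite sqrtr_ge0. Qed.

Lemma cnD z w : cn (z + w) <= cn z + cn w.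
Proof. exact: le_normcD. Qed.

Lemma cnN z : cn (- z) = cn z.
Proof. exact: normcN. Qed.

Lemma cnB z w : cn (z - w) <= cn z + cn w.
Proof. by rewrite -(cnN w); exact: cnD. Qed.

Lemma cnC z w : cn (z - w) = cn (w - z).
Proof. by rewrite -cnN opprB. Qed.

Lemma cn_tri z w y : cn (z - y) <= cn (z - w) + cn (w - y).
Proof. by rewrite -[z - y](subrKA w); exact: cnD. Qed.

Lemma cnM z w : cn (z * w) = cn z * cn w.
Proof. exact: Normc.normcM. Qed.

Lemma cnV z : cn z^-1 = (cn z)^-1.
Proof. exact: Normc.normcV. Qed.

Lemma cn0 : cn 0 = 0.
Proof. exact: Normc.normc0. Qed.

Lemma cn1 : cn 1 = 1.
Proof. exact: Normc.normc1. Qed.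

Lemma cnX z n : cn (z ^+ n) = cn z ^+ n.
Proof. by elim: n => [|n IH]; rewrite ?expr0 ?cn1 // !exprS cnM IH. Qed.

Lemma cn_eq0 z : cn z = 0 -> z = 0.
Proof. exact: Normc.eq0_normc. Qed.

Lemma cn_gt0 z : z != 0 -> 0 < cn z.
Proof.
by move=> z0; rewrite lt_neqAle cn_ge0 andbT eq_sym; apply: contra z0 => /eqP/cn_eq0->.
Qed.

Lemma cn_real x : cn (x%:C : C R) = `|x|.
Proof. by rewrite /cn /= expr0n /= addr0 sqrtr_sqr. Qed.

Lemma cn_nat n : cn n%:R = n%:R.
Proof. by rewrite -(rmorph_nat (real_complex R)) cn_real normr_nat. Qed.

Lemma cn_sum (I : Type) (r : seq I) (P : pred I) (F : I -> C R) :
  cn (\sum_(i <- r | P i) F i) <= \sum_(i <- r | P i) cn (F i).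
Proof.
elim/big_ind2 : _ => [|a x b y ha hb|//]; first by rewrite cn0.
by apply: le_trans (cnD _ _) _; exact: lerD.
Qed.

Lemma cn_sqr z : cn z ^+ 2 = complex.Re (z : R[i]) ^+ 2 + complex.Im (z : R[i]) ^+ 2.
Proof. by case: z => a b; rewrite /cn /= sqr_sqrtr // addr_ge0 ?sqr_ge0. Qed.

Lemma Re_le_cn z : `|complex.Re (z : R[i])| <= cn z.
Proof.
rewrite -(ler_pXn2r (n := 2)) ?nnegrE ?cn_ge0 ?normr_ge0 // real_normK ?num_real //.
by rewrite cn_sqr lerDl sqr_ge0.
Qed.

Lemma Im_le_cn z : `|complex.Im (z : R[i])| <= cn z.
Proof.
rewrite -(ler_pXn2r (n := 2)) ?nnegrE ?cn_ge0 ?normr_ge0 // real_normK ?num_real //.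
by rewrite cn_sqr lerDr sqr_ge0.
Qed.

Lemma cn_le_ReIm z : cn z <= `|complex.Re (z : R[i])| + `|complex.Im (z : R[i])|.
Proof.
rewrite -(ler_pXn2r (n := 2)) ?nnegrE ?cn_ge0 ?addr_ge0 ?normr_ge0 //.
rewrite cn_sqr sqrrD !real_normK ?num_real // -addrA lerD2l lerDr.
by rewrite mulrn_wge0 // mulr_ge0.
Qed.

Lemma cvg_cn (u : nat -> C R) (l : C R) :
  (forall e : R, 0 < e -> exists N, forall n, (N <= n)%N -> cn (u n - l) <= e) ->
  (u @ \oo --> l)%classic.
Proof.
move=> H; apply/cvgrPdist_le => e e0.
(* The order on [R[i]] makes a positive [e] a positive real number. *)
have /andP [/eqP i0 r0]: (complex.Im (e : R[i]) == 0) && (0 < complex.Re (e : R[i])).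
  by move: e0; rewrite [_ < _]ltcE /=.
have [N HN] := H _ r0.
exists N => // n /= Nn; rewrite norm_cn cnC [_ <= _]lecE /= i0 eqxx /=.
exact: HN.
Qed.

Lemma real_cauchy_cvg (u : nat -> R) :
  (forall e : R, 0 < e -> exists N, forall n, (N <= n)%N -> `|u n - u N| <= e) ->
  exists l, forall e : R, 0 < e -> exists N, forall n, (N <= n)%N -> `|u n - l| <= e.
Proof.
move=> H; have cu : cvgn u.
  apply: cauchy_cvg; apply: cauchy_exP => e e0.
  have [N HN] := H _ (divr_gt0 e0 (ltr0n R 2)).
  exists (u N); exists N => // n /= Nn; rewrite /ball /= distrC.
  by apply: le_lt_trans (HN _ Nn) _; rewrite ltr_pdivrMr // mulr_natr mulr2n ltrDl.
exists (limn u) => e e0; have /cvgrPdist_le /(_ e e0) [N _ HN] := cu.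
by exists N => n Nn; rewrite distrC; exact: HN.
Qed.

Lemma cauchy_cn (u : nat -> C R) :
  (forall e : R, 0 < e -> exists N, forall n, (N <= n)%N -> cn (u n - u N) <= e) ->
  exists l, forall e : R, 0 < e -> exists N, forall n, (N <= n)%N -> cn (u n - l) <= e.
Proof.
move=> H.
have [|a Ha] := @real_cauchy_cvg (fun n => complex.Re (u n : R[i])).
  move=> e /H [N HN]; exists N => n /HN; apply: le_trans.
  by apply: le_trans (Re_le_cn _); rewrite raddfB.
have [|b Hb] := @real_cauchy_cvg (fun n => complex.Im (u n : R[i])).
  move=> e /H [N HN]; exists N => n /HN; apply: le_trans.
  by apply: le_trans (Im_le_cn _); rewrite raddfB.
exists (a +i* b) => e e0.
have e2 : 0 < e / 2 by lra.
have [N1 H1] := Ha _ e2; have [N2 H2] := Hb _ e2.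
exists (maxn N1 N2) => n; rewrite geq_max => /andP [/H1 h1 /H2 h2].
apply: le_trans (cn_le_ReIm _) _; rewrite !raddfB /=; lra.
Qed.

End ComplexNorm.


(** * Roots of unity and Cauchy's estimate for polynomials *)

Section CauchyEstimate.
Variable R : realType.
Implicit Types (p q : {poly C R}).

(** ['X^n - 1] splits over the algebraically closed field [R[i]] and is separable in characteristic
    0, so it has [n] distinct roots; [n] distinct [n]-th roots of unity include a primitive one. *)
Lemma complex_prim_root_exists n : (0 < n)%N -> exists z : C R, n.-primitive_root z.
Proof.
move=> n_gt0.
have [r] := @closed_field_poly_normal R[i] ('X^n - 1).
rewrite (monicP _) ?monicXnsubC // scale1r => Dp.
have rn1: all n.-unity_root r by apply/allP=> z; rewrite -root_prod_XsubC -Dp.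
have sz_r: (n < (size r).+1)%N.
  by rewrite -(size_prod_XsubC r id) -Dp size_XnsubC.
have [|z] := hasP (has_prim_root n_gt0 rn1 _ sz_r); last by exists z.
by rewrite -separable_prod_XsubC -Dp separable_Xn_sub_1 // pnatr_eq0 -lt0n.
Qed.

(* [p`_n * r ^+ n] is the mean of [x ^- n * p.[r x]] over the [M]-th roots of
   unity [x], as soon as [M] exceeds [n] and the degree of [p]. *)
Lemma poly_cauchy_estimate0 p n (r B : R) : 0 <= r ->
  (forall z, cn z <= r -> cn p.[z] <= B) -> cn p`_n * r ^+ n <= B.
Proof.
move=> r0 HB; pose M := maxn (size p) n.+1.
have nM : (n < M)%N by rewrite /M leq_max ltnSn orbT.
have pM : (size p <= M)%N by rewrite /M leq_max leqnn.
have M0 : (0 < M)%N by exact: leq_trans nM.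
have [w pw] := @complex_prim_root_exists M M0.
have wM : w ^+ M = 1 by exact: prim_expr_order.
have cw : cn w = 1.
  by apply/eqP; rewrite -(@pexpr_eq1 _ _ M) ?cn_ge0 // -cnX wM cn1.
(* The exponent [(M - n) * k] stands for [- n * k], since [w ^+ M = 1]. *)
have E : \sum_(k < M) w ^+ ((M - n) * k) * p.[r%:C * w ^+ k] = M%:R * (p`_n * r%:C ^+ n).
  under eq_bigr => k _ do rewrite (horner_coef_wide _ pM) mulr_sumr.
  rewrite exchange_big /= (bigD1 (Ordinal nM)) //= [X in _ + X]big1 ?addr0 => [|i ni].
    rewrite (eq_bigr (fun=> p`_n * r%:C ^+ n)) ?sumr_const ?card_ord ?mulr_natl // => k _.
    have e : w ^+ ((M - n) * k) * w ^+ (k * n) = 1.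
      by rewrite [(k * n)%N]mulnC -exprD -mulnDl subnK 1?ltnW // exprM wM expr1n.
    rewrite exprMn -exprM -[RHS]mulr1 -e; ring.
  rewrite (eq_bigr (fun k : 'I_M => (p`_i * r%:C ^+ i) * (w ^+ (M - n + i)) ^+ k)); last first.
    move=> k _; rewrite exprMn -!exprM mulnDl exprD [(k * i)%N]mulnC; ring.
  rewrite -mulr_sumr; apply/eqP; rewrite mulf_eq0; apply/orP; right.
  (* As [0 < M - n + i < 2 * M], the only multiple of [M] that this exponent can be is [M] itself,
     which forces [i = n]. Otherwise the geometric sum over the powers of this root of unity
     vanishes. *)
  have x1 : w ^+ (M - n + i) - 1 != 0.
    rewrite subr_eq0 -(prim_order_dvd pw); apply: contra ni => /dvdnP [q Hq].
    have iM := ltn_ord i; apply/eqP/val_inj => /=.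
    have : (q < 2)%N by rewrite -(ltn_pmul2r M0); lia.
    by case: q Hq => [|[|//]] Hq _; lia.
  by rewrite -(mulrI_eq0 _ (mulfI x1)) -subrX1 exprAC wM expr1n subrr.
have : cn (M%:R * (p`_n * r%:C ^+ n)) <= M%:R * B.
  rewrite -E; apply: le_trans (cn_sum _ _ _) _.
  have -> : M%:R * B = \sum_(k < M) B by rewrite sumr_const card_ord mulr_natl.
  apply: ler_sum => k _; rewrite cnM cnX cw expr1n mul1r; apply: HB.
  by rewrite cnM cnX cw expr1n mulr1 cn_real ger0_norm.
by rewrite !cnM cn_nat cnX cn_real ger0_norm // ler_pM2l // ltr0n.
Qed.

(** Translation to the origin: the normalized derivatives at [a], already divided by factorials, are
    the coefficients of [p] in powers of [z - a]. *)
Lemma poly_cauchy_estimate p n (a : C R) (r B : R) : 0 <= r ->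
  (forall z, cn (z - a) <= r -> cn p.[z] <= B) -> cn p^`N(n).[a] * r ^+ n <= B.
Proof.
move=> r0 HB; pose q := \poly_(i < size p) p^`N(i).[a].
have qE h : q.[h] = p.[a + h].
  by rewrite horner_poly nderiv_taylor //; exact: mulrC.
have -> : p^`N(n).[a] = q`_n.
  rewrite coef_poly; case: ltnP => // ?; rewrite nderivn_poly0 ?horner0 //.
apply: poly_cauchy_estimate0 => // z zr; rewrite qE; apply: HB.
by rewrite addrC addKr.
Qed.

End CauchyEstimate.

(** * Uniform approximation by polynomials on discs *)

Section PolynomialApproximation.
Variable R : realType.
Implicit Types (p q : {poly C R}) (f g : C R -> C R) (S : C R -> Prop).

Definition disc (r : R) : C R -> Prop := fun z => cn z <= r.

Definition poly_approx S f :=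
  forall e : R, 0 < e -> exists p, forall z, S z -> cn (p.[z] - f z) <= e.

Lemma poly_approx_poly S p : poly_approx S (horner p).
Proof. by move=> e e0; exists p => z _; rewrite subrr cn0 ltW. Qed.

Lemma poly_approx_ext S f g : (forall z, S z -> f z = g z) ->
  poly_approx S f -> poly_approx S g.
Proof.
by move=> fg Hf e /Hf [p Hp]; exists p => z Sz; rewrite -fg //; exact: Hp.
Qed.

Lemma poly_approx_cst S (c : C R) : poly_approx S (fun=> c).
Proof. by apply: poly_approx_ext (poly_approx_poly S c%:P) => z _; rewrite hornerC. Qed.

Lemma poly_approx_id S : poly_approx S id.
Proof. by apply: poly_approx_ext (poly_approx_poly S 'X) => z _; rewrite hornerX. Qed.

Lemma poly_approx_unif S f :
  (forall e : R, 0 < e -> exists2 g, poly_approx S g &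
     forall z, S z -> cn (g z - f z) <= e) -> poly_approx S f.
Proof.
move=> H e e0; have e2 : 0 < e / 2 by lra.
have [g Hg gf] := H _ e2; have [p Hp] := Hg _ e2.
exists p => z Sz; apply: le_trans (cn_tri _ (g z) _) _.
have := Hp z Sz; have := gf z Sz; lra.
Qed.

Lemma poly_approxD S f g :
  poly_approx S f -> poly_approx S g -> poly_approx S (fun z => f z + g z).
Proof.
move=> Hf Hg e e0; have e2 : 0 < e / 2 by lra.
have [p Hp] := Hf _ e2; have [q Hq] := Hg _ e2.
exists (p + q) => z Sz; rewrite hornerD.
have -> : p.[z] + q.[z] - (f z + g z) = (p.[z] - f z) + (q.[z] - g z) by ring.
apply: le_trans (cnD _ _) _; have := Hp z Sz; have := Hq z Sz; lra.
Qed.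

Lemma poly_bounded p r : exists2 B : R, 0 < B & forall z, disc r z -> cn p.[z] <= B.
Proof.
exists (1 + \sum_(i < size p) cn p`_i * `|r| ^+ i).
  by rewrite ltr_pwDl // sumr_ge0 // => i _; rewrite mulr_ge0 ?cn_ge0 ?exprn_ge0.
move=> z zr; rewrite horner_coef; apply: le_trans (cn_sum _ _ _) _.
apply: le_trans (_ : \sum_(i < size p) cn p`_i * `|r| ^+ i <= _); last by lra.
apply: ler_sum => i _; rewrite cnM cnX ler_wpM2l ?cn_ge0 // lerXn2r ?nnegrE ?cn_ge0 //.
exact: le_trans zr (ler_norm _).
Qed.

Lemma poly_approx_bounded f r : poly_approx (disc r) f ->
  exists2 B : R, 0 < B & forall z, disc r z -> cn (f z) <= B.
Proof.
move=> /(_ 1 ltr01) [p Hp]; have [B B0 HB] := poly_bounded p r.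
exists (B + 1) => [|z zr]; first by lra.
have -> : f z = p.[z] - (p.[z] - f z) by ring.
apply: le_trans (cnB _ _) _; apply: lerD; [exact: HB | exact: Hp].
Qed.

(** Products of uniform limits need bounded factors, hence a disc instead of an arbitrary set. The
    tolerance for [q] depends on the bound [A] of [p], so [p] is chosen first. *)
Lemma poly_approxM f g r : poly_approx (disc r) f -> poly_approx (disc r) g ->
  poly_approx (disc r) (fun z => f z * g z).
Proof.
move=> Hf Hg e e0; have [B B0 HB] := poly_approx_bounded Hg.
have [p Hp] := Hf _ (divr_gt0 e0 (mulr_gt0 (ltr0Sn R 1) B0 : 0 < 2 * B)).
have [A A0 HA] := poly_bounded p r.
have [q Hq] := Hg _ (divr_gt0 e0 (mulr_gt0 (ltr0Sn R 1) A0 : 0 < 2 * A)).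
exists (p * q) => z Sz; rewrite hornerM.
have -> : p.[z] * q.[z] - f z * g z = p.[z] * (q.[z] - g z) + (p.[z] - f z) * g z by ring.
apply: le_trans (cnD _ _) _; rewrite !cnM.
have h1 := ler_pM (cn_ge0 _) (cn_ge0 _) (HA z Sz) (Hq z Sz).
have h2 := ler_pM (cn_ge0 _) (cn_ge0 _) (Hp z Sz) (HB z Sz).
apply: le_trans (lerD h1 h2) _.
have -> : A * (e / (2 * A)) = e / 2 by field; lra.
have -> : e / (2 * B) * B = e / 2 by field; lra.
lra.
Qed.

Lemma poly_approxX f r n : poly_approx (disc r) f ->
  poly_approx (disc r) (fun z => f z ^+ n).
Proof.
move=> Hf; elim: n => [|n IH].
  by apply: poly_approx_ext (poly_approx_cst _ 1) => z _; rewrite expr0.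
by apply: poly_approx_ext (poly_approxM Hf IH) => z _; rewrite exprS.
Qed.

Lemma poly_approx_sum S (I : Type) (s : seq I) (F : I -> C R -> C R) :
  (forall i, poly_approx S (F i)) -> poly_approx S (fun z => \sum_(i <- s) F i z).
Proof.
move=> H; elim: s => [|i s IH].
  by apply: poly_approx_ext (poly_approx_cst _ 0) => z _; rewrite big_nil.
by apply: poly_approx_ext (poly_approxD (H i) IH) => z _; rewrite big_cons.
Qed.

(** A polynomial in [g] is built from sums and products, and [f] composed with [g] is a uniform
    limit of such polynomials. *)
Lemma poly_approx_comp S f g r : poly_approx S f -> poly_approx (disc r) g ->
  (forall z, disc r z -> S (g z)) -> poly_approx (disc r) (fun z => f (g z)).
Proof.
move=> Hf Hg Sg; apply: poly_approx_unif => e /Hf [p Hp].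
exists (fun z => p.[g z]); last by move=> z /Sg; exact: Hp.
have H i : poly_approx (disc r) (fun z => p`_i * g z ^+ i).
  by apply: poly_approxM; [exact: poly_approx_cst | exact: poly_approxX].
have := poly_approx_sum (index_enum 'I_(size p)) (fun i : 'I__ => H i).
by apply: poly_approx_ext => z _; rewrite horner_coef.
Qed.

Lemma poly_approx_geometric (r : R) : r < 1 ->
  poly_approx (disc r) (fun z => (1 - z)^-1).
Proof.
(* A disc of negative radius is empty. *)
have [r0|r0] := ltP r 0.
  move=> _ e e0; exists 0 => z zr; have := cn_ge0 z; move: zr; rewrite /disc; lra.
move=> r1 e e0; pose b := e * (1 - r).
have b0 : 0 < b by rewrite /b mulr_gt0 // subr_gt0.
have /cvgrPdist_le /(_ _ b0) [N _ /(_ N (leqnn _))] := @cvg_geometric R 1 r ltac:(by rewrite ger0_norm).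
rewrite /= /geometric /= sub0r normrN mul1r ger0_norm ?exprn_ge0 // => HN.
(* The tail of the geometric series is [z ^+ N / (1 - z)], of modulus at most [r ^+ N / (1 - r)];
   this explains the factor [1 - r] in [b]. *)
exists (\poly_(i < N) 1) => z zr; rewrite horner_poly.
have z1 : 1 - z != 0.
  by apply: contraTneq zr => /subr0_eq <-; rewrite /disc cn1 -ltNge.
have cz : 1 - r <= cn (1 - z).
  have := cnD (1 - z) z; rewrite subrK cn1; move: zr; rewrite /disc; lra.
have -> : \sum_(i < N) 1 * z ^+ i - (1 - z)^-1 = - z ^+ N / (1 - z).
  apply: (mulIf z1); rewrite mulrBl mulfVK // mulVf //.
  under eq_bigr do rewrite mul1r.
  have := subrX1 z N => E; have -> : (\sum_(i < N) z ^+ i) * (1 - z) = - (z ^+ N - 1) by rewrite E; ring.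
  ring.
rewrite cnM cnN cnX cnV ler_pdivrMr; last by lra.
apply: le_trans (_ : r ^+ N <= _); first by rewrite lerXn2r ?nnegrE ?cn_ge0.
by apply: le_trans HN _; rewrite /b ler_pM2l.
Qed.

End PolynomialApproximation.


(** * Taylor coefficients, power series and derivatives of uniform limits of polynomials *)

Section TaylorCoefficients.
Variable R : realType.
Implicit Types (p q : {poly C R}) (f g : C R -> C R).

(** Used to let the error [d] of a polynomial approximation tend to 0 in an inequality. *)
Lemma le_of_le_addM (K x y : R) :
  (forall d, 0 < d -> d <= 1 -> x <= y + K * d) -> x <= y.
Proof.
move=> H; rewrite leNgt; apply/negP => yx.
pose d := Num.min 1 ((x - y) / (2 * (`|K| + 1))).
have K1 : 0 < `|K| + 1 by have := normr_ge0 K; lra.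
have d0 : 0 < d by rewrite lt_min ltr01 divr_gt0 ?subr_gt0 // mulr_gt0.
have := H d d0 ltac:(by rewrite ge_min lexx).
have h1 : K * d <= (`|K| + 1) * d by rewrite ler_pM2r //; have := ler_norm K; lra.
have h2 : (`|K| + 1) * d <= (`|K| + 1) * ((x - y) / (2 * (`|K| + 1))).
  by rewrite ler_pM2l // ge_min lexx orbT.
have h3 : (`|K| + 1) * ((x - y) / (2 * (`|K| + 1))) = (x - y) / 2 by field; lra.
by move=> h4; move: h2; rewrite h3; lra.
Qed.

Definition approx_on p f (r e : R) := forall z, disc r z -> cn (p.[z] - f z) <= e.

Definition analytic_on (rho : R) f := forall r, r < rho -> poly_approx (disc r) f.

Lemma approx_on_sub p f (r r' e : R) : r <= r' -> approx_on p f r' e -> approx_on p f r e.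
Proof. by move=> rr H z zr; apply: H; exact: le_trans rr. Qed.

(** Cauchy's estimate for [p - q], which is at most [e + e'] on the disc of radius [r - cn a] around
    [a], a part of [disc r]. *)
Lemma approx_on_cauchy p q f n (a : C R) (r e e' : R) : cn a <= r ->
  approx_on p f r e -> approx_on q f r e' ->
  cn (p^`N(n).[a] - q^`N(n).[a]) * (r - cn a) ^+ n <= e + e'.
Proof.
move=> ar Hp Hq; rewrite -hornerN -hornerD -linearB /=.
apply: poly_cauchy_estimate => [|z za]; first by rewrite subr_ge0.
have zr : disc r z.
  by rewrite /disc -[z](subrK a); apply: le_trans (cnD _ _) _; rewrite -lerBrDr.
rewrite hornerD hornerN; apply: le_trans (cn_tri _ (f z) _) _.
by rewrite lerD ?[cn (f z - _)]cnC; [| exact: Hp | exact: Hq].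
Qed.

(* The [n]-th Taylor coefficient of [f] at [a] is within the Cauchy bound of
   that of any polynomial close to [f]. *)
Definition taylor_coef_of (rho : R) f (T : nat -> C R -> C R) :=
  forall n a r p e, cn a < r -> r < rho -> approx_on p f r e ->
    cn (p^`N(n).[a] - T n a) * (r - cn a) ^+ n <= e.

(** For a fixed radius [r0] between [cn a] and [rho], Cauchy's estimate makes the [n]-th
    coefficients at [a] of polynomials [q N] tending to [f] a Cauchy sequence. Its limit serves for
    every other radius too. *)
Lemma taylor_coef_exists rho f : analytic_on rho f -> exists T, taylor_coef_of rho f T.
Proof.
move=> Hf.
suff H n a : exists l, forall r p e, cn a < r -> r < rho -> approx_on p f r e ->
    cn (p^`N(n).[a] - l) * (r - cn a) ^+ n <= e.
  have /choice [T HT] : forall na : nat * C R, exists l, forall r p e,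
      cn na.2 < r -> r < rho -> approx_on p f r e ->
      cn (p^`N(na.1).[na.2] - l) * (r - cn na.2) ^+ na.1 <= e.
    by move=> [n a]; exact: H.
  by exists (fun n a => T (n, a)) => n a; exact: (HT (n, a)).
have [ar|ar] := leP rho (cn a).
  (* Outside the disc no radius [r] qualifies, so any value will do. *)
  by exists 0 => r p e h1 h2; lra.
pose r0 := (cn a + rho) / 2; have r0a : cn a < r0 by rewrite /r0; lra.
have r0r : r0 < rho by rewrite /r0; lra.
have d0 : 0 < (r0 - cn a) ^+ n by rewrite exprn_gt0 // subr_gt0.
have /choice [q Hq] : forall N, exists p, approx_on p f r0 (N.+1%:R^-1).
  by move=> N; apply: Hf => //; rewrite invr_gt0.
have inv_small (e : R) : 0 < e -> exists N, forall n, (N <= n)%N -> n.+1%:R^-1 <= e.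
  move=> e0; exists (Num.truncn e^-1) => m Hm.
  rewrite -[e]invrK lef_pV2 ?posrE ?invr_gt0 //.
  apply: ltW; apply: lt_le_trans (truncnS_gt _) _.
  by rewrite ler_nat ltnS.
have [|l Hl] := @cauchy_cn R (fun N => (q N)^`N(n).[a]).
  move=> e e0; have [N HN] := inv_small (e * (r0 - cn a) ^+ n / 2) ltac:(by rewrite divr_gt0 ?mulr_gt0).
  exists N => m Nm; rewrite -(ler_pM2r d0).
  apply: le_trans (approx_on_cauchy n (ltW r0a) (Hq m) (Hq N)) _.
  apply: le_trans (lerD (HN _ Nm) (HN _ (leqnn N))) _; lra.
exists l => r p e ar' rr Hp; set D := (r0 - cn a) ^+ n in d0 *.
pose E := (r - cn a) ^+ n; have E0 : 0 < E by rewrite exprn_gt0 // subr_gt0.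
apply: (@le_of_le_addM (1 + E * (2 / D + 1))) => d dp _.
have [N1 HN1] := inv_small _ dp; have [N2 HN2] := Hl _ dp.
pose N := maxn N1 N2.
(* [p] and [q N] approximate [f] on different discs. A polynomial [p'] close to [f] on the larger
   one can be compared with each of them. *)
have [p' Hp'] := Hf (Num.max r r0) ltac:(by rewrite gt_max rr) _ dp.
have h1 : cn (p^`N(n).[a] - p'^`N(n).[a]) * E <= e + d.
  apply: approx_on_cauchy Hp _; first exact: ltW.
  by apply: approx_on_sub Hp'; rewrite le_max lexx.
have h2 : cn (p'^`N(n).[a] - (q N)^`N(n).[a]) <= 2 / D * d.
  have -> : 2 / D * d = (d + d) / D by field; exact: lt0r_neq0.
  rewrite ler_pdivlMr //.
  apply: le_trans (approx_on_cauchy n (ltW r0a) (f := f) (e := d) _ (Hq N)) _.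
    by apply: approx_on_sub Hp'; rewrite le_max lexx orbT.
  by rewrite lerD2l; apply: HN1; rewrite leq_maxl.
have h3 := HN2 N (leq_maxr _ _).
have h4 : cn (p^`N(n).[a] - l) <= cn (p^`N(n).[a] - p'^`N(n).[a]) + (2 / D * d + d).
  apply: le_trans (cn_tri _ p'^`N(n).[a] _) _; rewrite lerD2l.
  apply: le_trans (cn_tri _ (q N)^`N(n).[a] _) _; lra.
rewrite -/E; have := ler_wpM2r (ltW E0) h4; nra.
Qed.

(** This says that [a] is the coefficient sequence of [f] at 0, in a form that passes through
    algebraic operations: one polynomial is close to [f] on the disc and, at scale [r ^- n], has
    coefficients close to [a] uniformly in [n]. Convergence of the series is deduced from it. *)
Definition powser (rho : R) f (a : nat -> C R) :=
  forall r d, 0 < r -> r < rho -> 0 < d -> exists2 p, approx_on p f r d &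
    forall n, cn (p`_n - a n) * r ^+ n <= d.

Lemma taylor_powser rho f T : analytic_on rho f -> taylor_coef_of rho f T ->
  powser rho f (fun n => T n 0).
Proof.
move=> Hf HT r d r0 rr d0; have [p Hp] := Hf r rr d d0.
exists p => // n; have := HT n 0 r p d; rewrite cn0 subr0 => /(_ r0 rr Hp).
by rewrite horner_coef0 coef_nderivn addn0 binn mulr1n.
Qed.

Lemma powser_exists rho f : analytic_on rho f -> exists a, powser rho f a.
Proof.
move=> Hf; have [T HT] := taylor_coef_exists Hf.
by exists (fun n => T n 0); exact: taylor_powser.
Qed.

(** Cauchy's estimate for [f - g], transferred from approximating polynomials. The case [e = 0]
    gives uniqueness of coefficients, and [g = 0] gives their growth bound. *)
Lemma powser_le rho rho' f g a b r e n : powser rho f a -> powser rho' g b ->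
  0 < r -> r < rho -> r < rho' -> (forall z, disc r z -> cn (f z - g z) <= e) ->
  cn (a n - b n) * r ^+ n <= e.
Proof.
move=> Hf Hg r0 r1 r2 He.
apply: (@le_of_le_addM 4) => d d0 _.
have [p Hp pa] := Hf r d r0 r1 d0; have [q Hq qb] := Hg r d r0 r2 d0.
have h1 : cn (p`_n - q`_n) * r ^+ n <= e + 2 * d.
  rewrite -coefN -coefD; apply: poly_cauchy_estimate0; first exact: ltW.
  move=> z zr; rewrite hornerD hornerN.
  have := cn_tri p.[z] (f z) q.[z]; have := cn_tri (f z) (g z) q.[z].
  have := Hp z zr; have := Hq z zr; have := He z zr; rewrite (cnC q.[z]); lra.
have h2 : cn (a n - b n) <= cn (p`_n - a n) + cn (p`_n - q`_n) + cn (q`_n - b n).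
  have := cn_tri (a n) p`_n (b n); have := cn_tri p`_n q`_n (b n).
  rewrite (cnC (a n) p`_n); lra.
have rn : 0 <= r ^+ n by rewrite exprn_ge0 // ltW.
have := ler_wpM2r rn h2; have := pa n; have := qb n; rewrite !mulrDl; lra.
Qed.

Lemma powser0 rho : powser rho (fun=> 0) (fun=> 0).
Proof.
move=> r d _ _ d0; exists 0 => [z _|n]; first by rewrite horner0 subrr cn0 ltW.
by rewrite coef0 subrr cn0 mul0r ltW.
Qed.

Lemma powser_uniq rho rho' f g a b r : powser rho f a -> powser rho' g b ->
  0 < r -> r < rho -> r < rho' -> (forall z, disc r z -> f z = g z) -> a =1 b.
Proof.
move=> Hf Hg r0 r1 r2 fg n; apply/eqP; rewrite -subr_eq0; apply/eqP/cn_eq0.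
have rn : 0 < r ^+ n by rewrite exprn_gt0.
have : cn (a n - b n) * r ^+ n <= 0.
  by apply: (powser_le n Hf Hg) => // z zr; rewrite fg // subrr cn0.
by have := cn_ge0 (a n - b n); nra.
Qed.

Lemma powserD rho f g a b : powser rho f a -> powser rho g b ->
  powser rho (fun z => f z + g z) (fun n => a n + b n).
Proof.
move=> Hf Hg r d r0 rr d0; have d2 : 0 < d / 2 by lra.
have [p Hp pa] := Hf r _ r0 rr d2; have [q Hq qb] := Hg r _ r0 rr d2.
exists (p + q) => [z zr|n].
  rewrite hornerD.
  have -> : p.[z] + q.[z] - (f z + g z) = (p.[z] - f z) + (q.[z] - g z) by ring.
  by apply: le_trans (cnD _ _) _; have := Hp z zr; have := Hq z zr; lra.
rewrite coefD.
have -> : p`_n + q`_n - (a n + b n) = (p`_n - a n) + (q`_n - b n) by ring.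
have rn : 0 <= r ^+ n by rewrite exprn_ge0 // ltW.
have := ler_wpM2r rn (cnD (p`_n - a n) (q`_n - b n)).
have := pa n; have := qb n; rewrite !mulrDl; lra.
Qed.

Lemma powserZ rho f a (c : C R) : powser rho f a ->
  powser rho (fun z => c * f z) (fun n => c * a n).
Proof.
move=> Hf r d r0 rr d0; pose K := cn c + 1.
have K0 : 0 < K by rewrite /K; have := cn_ge0 c; lra.
have [p Hp pa] := Hf r _ r0 rr (divr_gt0 d0 K0).
have h x : x <= d / K -> cn c * x <= d.
  move=> xd; apply: le_trans (ler_wpM2l (cn_ge0 c) xd) _.
  rewrite mulrA ler_pdivrMr // mulrC ler_pM2l // /K; lra.
exists (c *: p) => [z zr|n].
  by rewrite hornerZ -mulrBr cnM; apply/h/Hp.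
by rewrite coefZ -mulrBr cnM -mulrA; apply/h/pa.
Qed.

Lemma powser_sum rho (F : nat -> C R -> C R) (A : nat -> nat -> C R) N :
  (forall i, powser rho (F i) (A i)) ->
  powser rho (fun z => \sum_(i < N) F i z) (fun n => \sum_(i < N) A i n).
Proof.
move=> H; elim: N => [|N IH].
  have -> : (fun z => \sum_(i < 0) F i z) = (fun=> 0) by apply/funext => z; rewrite big_ord0.
  have -> : (fun n => \sum_(i < 0) A i n) = (fun=> 0) by apply/funext => z; rewrite big_ord0.
  exact: powser0.
have := powserD IH (H N); congr powser; apply/funext => z; by rewrite big_ord_recr.
Qed.

Lemma powserMX rho f a : powser rho f a ->
  powser rho (fun z => z * f z) (fun n => if n is m.+1 then a m else 0).
Proof.
move=> Hf r d r0 rr d0; have [p Hp pa] := Hf r _ r0 rr (divr_gt0 d0 r0).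
exists (p * 'X) => [z zr|[|n]].
- rewrite hornerMX mulrC -mulrBr cnM -[d](mulfVK (lt0r_neq0 r0)) mulrC.
  by apply: ler_pM; rewrite ?cn_ge0 //; exact: Hp.
- by rewrite coefMX subrr cn0 mul0r ltW.
- by rewrite coefMX /= exprSr mulrA -ler_pdivlMr.
Qed.

Lemma powser_bound rho f a r : powser rho f a -> 0 < r -> r < rho ->
  exists2 B : R, 0 < B & forall n, cn (a n) * r ^+ n <= B.
Proof.
move=> Hf r0 rr; have [p Hp _] := Hf r 1 r0 rr ltr01.
have [A A0 HA] := poly_bounded p r; exists (A + 1); first lra.
move=> n; rewrite -[a n]subr0; apply: (powser_le n Hf (@powser0 rho)) => // z zr.
rewrite subr0; have := cn_tri (f z) p.[z] 0; rewrite !subr0 cnC.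
have := Hp z zr; have := HA z zr; lra.
Qed.

Lemma geometric_sum_le (x : R) n : 0 <= x -> x < 1 -> \sum_(i < n) x ^+ i <= (1 - x)^-1.
Proof.
move=> x0 x1; have y0 : 0 < 1 - x by rewrite subr_gt0.
rewrite -(ler_pM2l y0) mulfV ?lt0r_neq0 // -opprB mulNr -subrX1 opprB gerBl.
exact: exprn_ge0.
Qed.

(** Beyond the degree of an approximating polynomial [p] on a larger disc of radius [r], the partial
    sum differs from [p] only by coefficient errors of order [r ^- i], dominated by a geometric
    series of ratio [t / r]. *)
Lemma powser_cvg_unif rho f a (t : R) : powser rho f a -> 0 <= t -> t < rho ->
  forall e, 0 < e -> exists N, forall n, (N <= n)%N -> forall z, disc t z ->
    cn (\sum_(i < n) a i * z ^+ i - f z) <= e.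
Proof.
move=> Hf t0 tr e e0; pose r := (t + rho) / 2.
have r0 : 0 < r by rewrite /r; lra.
have rr : r < rho by rewrite /r; lra.
have rt : t < r by rewrite /r; lra.
pose x := t / r; have x0 : 0 <= x by rewrite divr_ge0 // ltW.
have x1 : x < 1 by rewrite ltr_pdivrMr // mul1r.
(* The two summands account for the coefficient errors and for the distance from [p] to [f]. *)
pose K := (1 - x)^-1 + 1; have K0 : 0 < K by rewrite ltr_pwDr // invr_ge0 subr_ge0 ltW.
have [p Hp pa] := Hf r _ r0 rr (divr_gt0 e0 K0).
exists (size p) => n Hn z zt.
have -> : \sum_(i < n) a i * z ^+ i - f z =
    (p.[z] - f z) - \sum_(i < n) (p`_i - a i) * z ^+ i.
  rewrite (horner_coef_wide _ Hn).
  rewrite [X in _ = _ - X](eq_bigr (fun i : 'I_n => p`_i * z ^+ i - a i * z ^+ i)).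
    by rewrite sumrB; ring.
  by move=> i _; rewrite mulrBl.
apply: le_trans (cnB _ _) _.
have h1 : cn (p.[z] - f z) <= e / K by apply: Hp; rewrite /disc (le_trans zt) // ltW.
have h2 : cn (\sum_(i < n) (p`_i - a i) * z ^+ i) <= e / K * (1 - x)^-1.
  apply: le_trans (cn_sum _ _ _) _.
  apply: le_trans (_ : \sum_(i < n) e / K * x ^+ i <= _); last first.
    rewrite -mulr_sumr ler_pM2l ?divr_gt0 //; exact: geometric_sum_le.
  apply: ler_sum => i _; rewrite cnM cnX.
  have rn : 0 < r ^+ i by rewrite exprn_gt0.
  rewrite /x exprMn exprVn mulrA ler_pdivlMr // mulrAC.
  apply: ler_pM; rewrite ?mulr_ge0 ?exprn_ge0 ?cn_ge0 //; first exact: ltW.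
  by rewrite lerXn2r ?nnegrE ?cn_ge0.
have -> : e = e / K * 1 + e / K * (1 - x)^-1.
  have KE : 1 + (1 - x)^-1 = K by rewrite /K addrC.
  by rewrite -mulrDr KE mulfVK // lt0r_neq0.
by rewrite lerD // mulr1.
Qed.

Lemma powser_cvg rho f a z : powser rho f a -> cn z < rho ->
  (series (fun n => a n * z ^+ n) @ \oo --> f z)%classic.
Proof.
move=> Hf zr; apply: cvg_cn => e e0.
have [N HN] := powser_cvg_unif Hf (cn_ge0 z) zr e0.
by exists N => n Nn; rewrite /series /= big_mkord; apply: HN => //; exact: lexx.
Qed.

Lemma powser_abs_cvg rho f a z : powser rho f a -> cn z < rho ->
  cvgn (series (fun n => cn (a n * z ^+ n))).
Proof.
move=> Hf zr; pose r := (cn z + rho) / 2; have z0 := cn_ge0 z.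
have r0 : 0 < r by rewrite /r; lra.
have rr : r < rho by rewrite /r; lra.
have rt : cn z < r by rewrite /r; lra.
have x0 : 0 <= cn z / r by rewrite divr_ge0 // ltW.
have [B B0 HB] := powser_bound Hf r0 rr.
apply: (@series_le_cvg _ _ (geometric B (cn z / r))) => [n|n|n|].
- exact: cn_ge0.
- by rewrite /geometric /= mulr_ge0 ?exprn_ge0 // ltW.
- rewrite /geometric /= cnM cnX exprMn exprVn mulrA ler_pdivlMr ?exprn_gt0 // mulrAC.
  by rewrite ler_wpM2r ?exprn_ge0.
- apply: is_cvg_geometric_series.
  by rewrite ger0_norm // ltr_pdivrMr // mul1r.
Qed.

Lemma approx_on_derivn rho f T p n (b : C R) (r e : R) : taylor_coef_of rho f T ->
  cn b < r -> r < rho -> approx_on p f r e ->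
  cn (p^`(n).[b] - n`!%:R * T n b) <= n`!%:R / (r - cn b) ^+ n * e.
Proof.
move=> HT br rr Hp; have := HT n b r p e br rr Hp.
have rb : 0 < (r - cn b) ^+ n by rewrite exprn_gt0 // subr_gt0.
rewrite -ler_pdivlMr // => h.
rewrite nderivn_def hornerMn -mulr_natl -mulrBr cnM cn_nat -mulrA [_^-1 * e]mulrC.
by rewrite ler_wpM2l.
Qed.

(** The second-order Taylor bound holds for the [n]-th derivative of each polynomial close to [f],
    with a constant independent of that polynomial, so it survives in the limit. It shows that
    [n]!%:R * T n[has derivative]n.+1[!%:R * T n.+1]. *)
Lemma taylor_coef_diff rho f T n (a : C R) : analytic_on rho f ->
  taylor_coef_of rho f T -> cn a < rho ->
  exists K, exists2 d, 0 < d & forall h, cn h <= d ->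
    cn (n`!%:R * T n (a + h) - n`!%:R * T n a - h * (n.+1`!%:R * T n.+1 a))
      <= K * cn h ^+ 2.
Proof.
(* Of the radius [3 * d] around [a], [2 * d] is for the Taylor expansion of the [n]-th derivative
   and [d] for the Cauchy estimate that bounds this derivative; a fourth [d] keeps [r] below
   [rho]. *)
move=> Hf HT ar; pose d := (rho - cn a) / 4; have d0 : 0 < d by rewrite /d; lra.
pose r := cn a + 3 * d; have rr : r < rho by rewrite /r /d; lra.
have [B B0 HB] := poly_approx_bounded (Hf r rr).
pose B' := n`!%:R * (B + 1) / d ^+ n.
have B'0 : 0 < B' by rewrite divr_gt0 ?exprn_gt0 // mulr_gt0 ?ltr0n ?fact_gt0 //; lra.
exists (B' / (2 * d) ^+ 2 * 2), d => // h hd.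
have ahr : cn (a + h) < r by have := cnD a h; rewrite /r; lra.
have ar' : cn a < r by rewrite /r; lra.
pose K1 := n`!%:R / (r - cn (a + h)) ^+ n.
pose K2 := n`!%:R / (r - cn a) ^+ n.
pose K3 := n.+1`!%:R / (r - cn a) ^+ n.+1.
apply: (@le_of_le_addM (K1 + K2 + cn h * K3)) => e e0 e1.
have [p Hp] := Hf r rr e e0; pose q := p^`(n).
have E1 := approx_on_derivn n HT ahr rr Hp.
have E2 := approx_on_derivn n HT ar' rr Hp.
have E3 := approx_on_derivn n.+1 HT ar' rr Hp.
have qB y : cn (y - a) <= 2 * d -> cn q.[y] <= B'.
  move=> ya; rewrite /q nderivn_def hornerMn -mulr_natl cnM cn_nat /B' -mulrA.
  rewrite ler_wpM2l // ler_pdivlMr ?exprn_gt0 //.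
  apply: poly_cauchy_estimate => [|z zy]; first exact: ltW.
  have zr : disc r z.
    rewrite /disc /r; have := cnD (z - y) y; have := cnD (y - a) a; rewrite !subrK; lra.
  have := cn_tri p.[z] (f z) 0; rewrite !subr0.
  have := Hp z zr; have := HB z zr; lra.
have Q : cn (q.[a + h] - q.[a] - h * q^`().[a]) <= B' / (2 * d) ^+ 2 * 2 * cn h ^+ 2.
  have sq : (size q <= (size q).+2)%N by rewrite -addn2 leq_addr.
  have -> : q.[a + h] - q.[a] - h * q^`().[a] =
      \sum_(i < size q) q^`N(i.+2).[a] * h ^+ i.+2.
    rewrite (nderiv_taylor_wide _ sq); last exact: mulrC.
    by rewrite !big_ord_recl /= nderivn0 nderivn1 expr0 /bump /= expr1; ring.
  apply: le_trans (cn_sum _ _ _) _.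
  (* The terms from degree 2 on are dominated by a geometric series of ratio [x <= 1 / 2], whose sum
     is at most 2. *)
  pose x := cn h / (2 * d).
  have x0 : 0 <= x by rewrite divr_ge0 ?cn_ge0 //; lra.
  have x2 : x <= 1 / 2 by rewrite ler_pdivrMr; lra.
  apply: le_trans (_ : \sum_(i < size q) (B' * x ^+ 2) * x ^+ i <= _).
    apply: ler_sum => i _; rewrite cnM cnX -mulrA -exprD add2n.
    have -> : cn h ^+ i.+2 = (2 * d) ^+ i.+2 * x ^+ i.+2.
      by rewrite -exprMn /x [_ / _]mulrC mulVKf // lt0r_neq0 // mulr_gt0.
    rewrite mulrA ler_wpM2r ?exprn_ge0 //.
    by apply: poly_cauchy_estimate => //; lra.
  rewrite -mulr_sumr.
  have -> : B' / (2 * d) ^+ 2 * 2 * cn h ^+ 2 = B' * x ^+ 2 * 2 by rewrite /x; field; lra.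
  have Bx : 0 <= B' * x ^+ 2 by rewrite mulr_ge0 ?exprn_ge0 // ltW.
  apply: ler_wpM2l => //; have x1 : x < 1 by lra.
  apply: le_trans (geometric_sum_le _ x0 x1) _.
  by rewrite -[2]invrK lef_pV2 ?posrE; lra.
move: E1 E2 E3 Q; rewrite derivnS -/K1 -/K2 -/K3 -/q.
set t1 := _ * T n (a + h); set t2 := _ * T n a; set t3 := _ * T n.+1 a => E1 E2 E3 Q.
have -> : t1 - t2 - h * t3 = (q.[a + h] - q.[a] - h * q^`().[a]) - (q.[a + h] - t1)
   + ((q.[a] - t2) + h * (q^`().[a] - t3)) by ring.
apply: le_trans (cnD _ _) _.
have := cnB (q.[a + h] - q.[a] - h * q^`().[a]) (q.[a + h] - t1).
have := cnD (q.[a] - t2) (h * (q^`().[a] - t3)).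
have := ler_wpM2l (cn_ge0 h) E3; rewrite -cnM.
move: Q; set Z := B' / _ * _ * _; clearbody Z K1 K2 K3; lra.
Qed.

Lemma derive1_quadratic (G : C R -> C R) (y g : C R) (K d : R) : 0 < d ->
  (forall h, cn h <= d -> cn (G (y + h) - G y - h * g) <= K * cn h ^+ 2) ->
  derive1 G y = g.
Proof.
move=> d0 H; rewrite /derive1; apply: cvg_lim; first exact: norm_hausdorff.
apply/cvgrPdist_le => e e0.
have /andP [/eqP i0 r0]: (complex.Im (e : R[i]) == 0) && (0 < complex.Re (e : R[i])).
  by move: e0; rewrite [_ < _]ltcE /=.
pose K1 := `|K| + 1; have K0 : 0 < K1 by rewrite /K1; have := normr_ge0 K; lra.
pose d' := Num.min d (complex.Re (e : R[i]) / K1).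
have d'0 : 0 < d' by rewrite lt_min d0 divr_gt0.
(* Radii of balls in [C R] are elements of [C R]. *)
have dC : 0 < (d'%:C : C R) by rewrite [_ < _]ltcE /= eqxx.
exists (d'%:C) => //= h; rewrite /ball /= sub0r normrN norm_cn [_ < _]ltcE /= eqxx /=.
rewrite lt_min => /andP [hd he] h0.
have ch := cn_gt0 h0.
rewrite norm_cn cnC [_ <= _]lecE /= i0 eqxx /=.
have -> : h^-1 *: (G (h + y) - G y) - g = h^-1 * (G (y + h) - G y - h * g).
  by rewrite mulrBr mulKf // [h + y]addrC.
rewrite cnM cnV mulrC ler_pdivrMr //; apply: le_trans (H _ (ltW hd)) _.
rewrite expr2 mulrA ler_pM2r //.
apply: le_trans (_ : K1 * cn h <= _); last by rewrite mulrC -ler_pdivlMr // ltW.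
by rewrite ler_pM2r // /K1; have := ler_norm K; lra.
Qed.

(** The induction covers all [t] in the disc, because differentiating once more at [t] requires the
    previous derivative on a neighbourhood of [t]. *)
Lemma derive1n_taylor rho f T (H : C R -> C R) (c : C R) n :
  analytic_on rho f -> taylor_coef_of rho f T ->
  (forall t, cn t < rho -> H (c + t) = f t) ->
  forall t, cn t < rho -> derive1n n H (c + t) = n`!%:R * T n t.
Proof.
move=> Hf HT Hc; elim: n => [|n IH] t tr.
  rewrite derive1n0 Hc // fact0 mul1r.
  apply/eqP; rewrite -subr_eq0; apply/eqP/cn_eq0/eqP; rewrite eq_le cn_ge0 andbT.
  pose r := (cn t + rho) / 2; have tr' : cn t < r by rewrite /r; lra.
  have rr : r < rho by rewrite /r; lra.
  apply: (@le_of_le_addM 2) => d d0 _; have [p Hp] := Hf r rr d d0.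
  have := HT 0%N t r p d tr' rr Hp; rewrite expr0 mulr1 nderivn0.
  have := Hp t (ltW tr'); have := cn_tri (f t) p.[t] (T 0%N t); rewrite (cnC (f t) p.[t]); lra.
rewrite derive1nS.
have [K [d d0 Hd]] := taylor_coef_diff n Hf HT tr.
(* The second bound keeps [t + h] in the disc, where the induction hypothesis applies. *)
pose d' := Num.min d ((rho - cn t) / 2).
have d'0 : 0 < d' by rewrite lt_min d0 /=; lra.
apply: (derive1_quadratic (K := K) d'0) => h; rewrite le_min => /andP [hd hr].
have thr : cn (t + h) < rho by have := cnD t h; lra.
by rewrite -(addrA c) !IH //; exact: Hd.
Qed.

End TaylorCoefficients.


(** * The complex exponential as a uniform limit of polynomials *)

Section ComplexExponential.
Variable R : realType.
Implicit Types (x y : R) (z w : C R).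

Definition cexp z : C R :=
  let: x +i* y := (z : R[i]) in (expR x * cos y) +i* (expR x * sin y).

Lemma cpowE x z : cpow x z = cexp (z * (ln x)%:C).
Proof. by case: z => a b; rewrite /cpow /cexp /= !mulr0 subr0 add0r. Qed.

Lemma cexp0 : cexp 0 = 1.
Proof. by rewrite /cexp /= expR0 cos0 sin0 mulr0 mulr1. Qed.

Lemma cexpD z w : cexp (z + w) = cexp z * cexp w.
Proof.
case: z w => [a b] [c d]; rewrite /cexp /=; apply/eqP; rewrite eq_complex /=.
by rewrite expRD cosD sinD; apply/andP; split; apply/eqP; ring.
Qed.

Lemma cexp_mulrn z n : cexp (z *+ n) = cexp z ^+ n.
Proof. by elim: n => [|n IH]; rewrite ?mulr0n ?cexp0 // mulrS cexpD IH exprS. Qed.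

Lemma cn_cexp z : cn (cexp z) = expR (complex.Re (z : R[i])).
Proof.
case: z => a b; rewrite /cn /cexp /= !exprMn -mulrDr cos2Dsin2 mulr1 sqrtr_sqr.
by rewrite ger0_norm ?expR_ge0.
Qed.

Lemma cexp_real x : cexp (x%:C) = (expR x)%:C.
Proof. by rewrite /cexp /= cos0 sin0 mulr1 mulr0. Qed.

Lemma sin_MVT y : exists2 c, `|c| <= `|y| & sin y = cos c * y.
Proof.
wlog y0 : y / 0 <= y => [H|].
  have [/H//|/ltW y0] := leP 0 y.
  have [|c] := H (- y); first by rewrite oppr_ge0.
  by rewrite normrN sinN mulrN => hc /oppr_inj E; exists c.
have cs : {within `[0, y], continuous (@sin R)}%classic.
  exact/continuous_subspaceT/continuous_sin.
have [c] := MVT_segment y0 (fun x _ => is_derive_sin x) cs.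
rewrite in_itv /= => /andP [c0 cy]; rewrite sin0 !subr0 => E.
by exists c => //; rewrite !ger0_norm.
Qed.

Lemma sin_le_norm y : `|sin y| <= `|y|.
Proof.
by have [c _ ->] := sin_MVT y; rewrite normrM ler_piMl // cos_max.
Qed.

(** By the half-angle formula [cos y = 1 - 2 * sin (y / 2) ^+ 2]. *)
Lemma cos_ge1Bsqr y : 1 - y ^+ 2 / 2 <= cos y.
Proof.
have E : cos y = 1 - 2 * sin (y / 2) ^+ 2.
  have {1}-> : y = (y / 2) *+ 2 by rewrite -mulr_natr; field.
  by rewrite cos_mulr2n cos2sin2 -mulr_natl; ring.
have : sin (y / 2) ^+ 2 <= (y / 2) ^+ 2.
  rewrite -[X in X <= _]real_normK ?num_real // -[X in _ <= X]real_normK ?num_real //.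
  by rewrite lerXn2r ?nnegrE // sin_le_norm.
rewrite E; nra.
Qed.

Lemma sin_sub_le y : `|y| <= 1 -> `|sin y - y| <= y ^+ 2 / 2.
Proof.
move=> y1; have [c cy ->] := sin_MVT y.
have -> : cos c * y - y = (cos c - 1) * y by ring.
have h1 : `|cos c - 1| <= y ^+ 2 / 2.
  have := cos_le1 c; have := cos_ge1Bsqr c => h2 h3.
  have h4 : c ^+ 2 <= y ^+ 2.
    by rewrite -[c ^+ 2]real_normK ?num_real // -[y ^+ 2]real_normK ?num_real // lerXn2r ?nnegrE.
  by rewrite ler0_norm; lra.
rewrite normrM; apply: le_trans (_ : y ^+ 2 / 2 * 1 <= _); last by rewrite mulr1.
by apply: ler_pM.
Qed.

Lemma cexp_quadratic z : cn z <= 1 / 2 -> cn (cexp z - 1 - z) <= 4 * cn z ^+ 2.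
Proof.
move=> z1; have hx := le_trans (Re_le_cn z) z1; have hy := le_trans (Im_le_cn z) z1.
rewrite cn_sqr; apply: le_trans (cn_le_ReIm _) _.
case: z {z1} hx hy => x y /= hx hy.
rewrite oppr0 addr0; set E := expR x.
have E0 : 1 + x <= E by exact: expR_ge1Dx.
have E0' : 0 < E by exact: expR_gt0.
have E1 : E * (1 - x) <= 1.
  apply: le_trans (_ : E * expR (- x) <= _); last by rewrite /E expRxMexpNx_1.
  by rewrite ler_pM2l //; have := expR_ge1Dx (- x).
move: (hx) (hy); rewrite !ler_norml => /andP [x1 x2] /andP [y1 y2].
(* After multiplication by [1 - x], the right-hand side is [1 + x ^+ 2 * (1 - 2 * x)], at least 1,
   while [E * (1 - x) <= 1]. *)
have E2 : E <= 1 + x + 2 * x ^+ 2.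
  have p : 0 < 1 - x by lra.
  rewrite -(ler_pM2r p).
  apply: le_trans E1 _.
  have : 0 <= x ^+ 2 * (1 - 2 * x) by apply: mulr_ge0; [exact: sqr_ge0 | lra].
  nra.
have E3 : E <= 2 by nra.
have re : `|E * cos y - 1 - x| <= 2 * x ^+ 2 + y ^+ 2.
  have := cos_le1 y; have := cos_ge1Bsqr y => c1 c2.
  by rewrite ler_norml; apply/andP; split; nra.
have im : `|E * sin y - y| <= (x ^+ 2 + y ^+ 2) + y ^+ 2 / 2.
  have -> : E * sin y - y = (E - 1) * sin y + (sin y - y) by ring.
  apply: le_trans (ler_normD _ _) _; apply: lerD; last by apply: sin_sub_le; lra.
  rewrite normrM; have e1 : `|E - 1| <= 2 * `|x|.
    have [x0|x0] := leP 0 x.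
      by rewrite (ger0_norm x0) ger0_norm; nra.
    rewrite (ltr0_norm x0) ler0_norm; first lra.
    rewrite subr_le0 /E expR_le1; exact: ltW.
  apply: le_trans (ler_pM _ _ e1 (sin_le_norm y)) _ => //.
  rewrite -[x ^+ 2]real_normK ?num_real // -[y ^+ 2]real_normK ?num_real //.
  have := sqr_ge0 (`|x| - `|y|); nra.
have := sqr_ge0 x; have := sqr_ge0 y; lra.
Qed.

(* [cexp z = cexp (z / n) ^+ n] is close to [(1 + z / n) ^+ n]. *)
Lemma poly_approx_cexp r : poly_approx (disc r) cexp.
Proof.
have [r0|r0] := ltP r 0.
  by move=> e e0; exists 0 => z zr; have := cn_ge0 z; move: zr; rewrite /disc; lra.
(* The summand [2 * r] gives [r / n <= 1 / 2], as [cexp_quadratic] requires; the other one brings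
   the final error [4 * r ^+ 2 * expR r / n] below [e]. *)
move=> e e0; pose K := 4 * r ^+ 2 * expR r / e + 2 * r.
pose n := (Num.truncn K).+1; have Kn : K < n%:R by exact: truncnS_gt.
have n0 : 0 < n%:R :> R by rewrite ltr0n.
have K1 : 0 <= 4 * r ^+ 2 * expR r / e.
  by rewrite divr_ge0 ?mulr_ge0 ?sqr_ge0 ?expR_ge0 // ltW.
have nC : (n%:R : C R) != 0 by rewrite pnatr_eq0.
exists ((1 + n%:R^-1 *: 'X) ^+ n) => z zr.
rewrite horner_exp hornerD hornerZ hornerX hornerC [_ * z]mulrC.
have {2}-> : z = (z / n%:R) *+ n by rewrite -mulr_natr mulfVK.
rewrite cexp_mulrn; set w := z / n%:R.
have cw : cn w <= r / n%:R by rewrite cnM cnV cn_nat ler_pM2r // invr_gt0.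
have rn : r / n%:R <= 1 / 2 by rewrite ler_pdivrMr //; rewrite /K in Kn; lra.
have ew : expR (r / n%:R) ^+ n = expR r by rewrite -expRM_natr mulfVK // lt0r_neq0.
have a1 : cn (cexp w) <= expR (r / n%:R).
  rewrite cn_cexp ler_expR; apply: le_trans cw; apply: le_trans (Re_le_cn w).
  exact: ler_norm.
have b1 : cn (1 + w) <= expR (r / n%:R).
  apply: le_trans (expR_ge1Dx _); apply: le_trans (cnD _ _) _; by rewrite cn1 lerD2l.
have d1 : cn (1 + w - cexp w) <= 4 * (r / n%:R) ^+ 2.
  rewrite cnC opprD addrA; apply: le_trans (cexp_quadratic (le_trans cw rn)) _.
  by rewrite ler_pM2l // lerXn2r ?nnegrE ?cn_ge0 // divr_ge0 // ltW.
(* Factoring a difference of [n]-th powers leaves a cofactor of [n] terms, each at most [expR r],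
   against a first factor of order [n ^- 2]. *)
rewrite subrXX cnM.
have d2 : cn (\sum_(i < n) (1 + w) ^+ (n.-1 - i) * cexp w ^+ i) <= n%:R * expR r.
  apply: le_trans (cn_sum _ _ _) _.
  have -> : n%:R * expR r = \sum_(i < n) expR r by rewrite sumr_const card_ord mulr_natl.
  apply: ler_sum => i _; rewrite cnM !cnX.
  apply: le_trans (_ : expR (r / n%:R) ^+ (n.-1 - i) * expR (r / n%:R) ^+ i <= _).
    by apply: ler_pM; rewrite ?exprn_ge0 ?cn_ge0 // lerXn2r ?nnegrE ?cn_ge0 ?expR_ge0.
  rewrite -exprD subnK; last by have := ltn_ord i; lia.
  rewrite -ew; apply: ler_weXn2l; last by lia.
  have := expR_ge1Dx (r / n%:R); have : 0 <= r / n%:R by rewrite divr_ge0 // ltW.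
  lra.
apply: le_trans (ler_pM (cn_ge0 _) (cn_ge0 _) d1 d2) _.
have -> : 4 * (r / n%:R) ^+ 2 * (n%:R * expR r) = (4 * r ^+ 2 * expR r / e) * e / n%:R.
  by field; rewrite !lt0r_neq0.
rewrite ler_pdivrMr // mulrC ler_pM2l //; move: K1 Kn; rewrite /K.
set Q := _ / e; lra.
Qed.

End ComplexExponential.


(** * Locally uniform approximation of [(s - 1) * zeta s] *)

Section ZetaApproximation.
Variable R : realType.
Implicit Types (s z : C R) (M : R).

(* [s - 1] times the sequence whose limit defines [zeta s]; it also makes sense
   at the pole, where it is constantly [1]. *)
Definition zeta_partial (N : nat) s : C R :=
  (s - 1) * \sum_(1 <= n < N.+1) cpow (n%:R : R) (- s) + cpow (N%:R : R) (1 - s).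

(** Here [cexp v] is [(n / (n + 1)) ^ (1 - s)]. With [(n + 1) ^ (1 - s)] factored out, the
    first-order terms of the bracket cancel, as [v] is close to [(s - 1) / (n + 1)]. *)
Lemma zeta_partialS n s : (0 < n)%N ->
  let v := (1 - s) * (ln (n%:R : R) - ln (n.+1%:R : R))%:C in
  zeta_partial n.+1 s - zeta_partial n s =
  cexp ((1 - s) * (ln (n.+1%:R : R))%:C) * (1 - cexp v + (s - 1) / n.+1%:R).
Proof.
move=> n0 v; rewrite /zeta_partial big_nat_recr //=.
set S := \sum_(1 <= i < n.+1) _; rewrite !cpowE.
set L := (ln (n.+1%:R : R))%:C; set l := (ln (n%:R : R))%:C.
have nC : (n.+1%:R : C R) != 0 by rewrite pnatr_eq0.
have eL : cexp L = n.+1%:R.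
  by rewrite /L cexp_real lnK ?posrE ?ltr0n // rmorph_nat.
have -> : cexp (- s * L) = cexp ((1 - s) * L) / n.+1%:R.
  by apply: (mulIf nC); rewrite mulfVK // -[in LHS]eL -cexpD; congr cexp; ring.
have -> : cexp ((1 - s) * l) = cexp ((1 - s) * L) * cexp v.
  by rewrite -cexpD /v rmorphB /=; congr cexp; rewrite -/L -/l; ring.
ring.
Qed.

(** Bounds [(n + 1) ^ (-3/2)] by a telescoping difference: with [b ^+ 2 - a ^+ 2 = 1], the
    right-hand side is [2 / (a * b * (b + a))], and [a <= b]. *)
Lemma inv_sqrtS_le (n : nat) : (0 < n)%N ->
  Num.sqrt (n.+1%:R : R) / n.+1%:R ^+ 2 <=
  2 * ((Num.sqrt (n%:R : R))^-1 - (Num.sqrt (n.+1%:R : R))^-1).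
Proof.
move=> n0; set a := Num.sqrt (n%:R : R); set b := Num.sqrt (n.+1%:R : R).
have a0 : 0 < a by rewrite sqrtr_gt0 ltr0n.
have b0 : 0 < b by rewrite sqrtr_gt0 ltr0n.
have aE : a ^+ 2 = n%:R by rewrite sqr_sqrtr.
have bE : b ^+ 2 = n.+1%:R by rewrite sqr_sqrtr.
have ab : a <= b by rewrite ler_sqrt ?ler_nat.
have ba : b ^+ 2 - a ^+ 2 = 1 by rewrite aE bE -natr1; ring.
rewrite -bE.
have -> : b / (b ^+ 2) ^+ 2 = (b ^+ 3)^-1 by field; rewrite lt0r_neq0.
have -> : 2 * (a^-1 - b^-1) = 2 * (b ^+ 2 - a ^+ 2) / (a * b * (b + a)).
  field; rewrite !lt0r_neq0 //; exact: addr_gt0.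
rewrite ba mulr1 -[X in X <= _]mul1r.
have d0 : 0 < a * b * (b + a) by rewrite !mulr_gt0 // addr_gt0.
rewrite ler_pdivrMr ?exprn_gt0 // mulrAC ler_pdivlMr // mul1r.
have -> : 2 * b ^+ 3 = b * b * (b + b) by ring.
have [a0' b0'] : 0 <= a /\ 0 <= b by split; exact: ltW.
apply: ler_pM; [exact: mulr_ge0 | exact: addr_ge0 | exact: ler_wpM2r | by rewrite lerD2l].
Qed.

Lemma zeta_partial_step M s n : (0 < n)%N -> 4 * M <= n.+1%:R ->
  2^-1 <= complex.Re (s : R[i]) -> cn (1 - s) <= M ->
  cn (zeta_partial n.+1 s - zeta_partial n s) <=
  2 * (16 * M ^+ 2 + 2 * M) * ((Num.sqrt (n%:R : R))^-1 - (Num.sqrt (n.+1%:R : R))^-1).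
Proof.
move=> n0 nM hs sM; have M0 : 0 <= M := le_trans (cn_ge0 _) sM.
rewrite (zeta_partialS s n0).
set v := _ * (_ - _)%:C; set L := ln (n.+1%:R : R); set l := ln (n%:R : R).
have x0 : 0 < n%:R :> R by rewrite ltr0n.
have X0 : 0 < n.+1%:R :> R by rewrite ltr0n.
have x1 : 1 <= n%:R :> R by rewrite (ler_nat R 1).
have XE : n.+1%:R = n%:R + 1 :> R by rewrite natr1.
(* The inequalities [e1] to [e4] place [L - l] between [y] and [y + 2 * y ^+ 2], where [y] is the
   inverse of [n + 1]. *)
have e1 : l - L <= - n.+1%:R^-1.
  rewrite /l /L -ln_div ?posrE //.
  have -> : n%:R / n.+1%:R = 1 + (- n.+1%:R^-1) :> R.
    by rewrite XE; field; rewrite -XE lt0r_neq0.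
  by apply: le_ln1Dx; rewrite ltrN2 invf_lt1 // XE; lra.
have e2 : L - l <= n%:R^-1.
  rewrite /l /L -ln_div ?posrE //.
  have -> : n.+1%:R / n%:R = 1 + n%:R^-1 :> R.
    by rewrite XE; field; rewrite lt0r_neq0.
  by apply: le_ln1Dx; apply: lt_trans (_ : 0 < _); rewrite ?invr_gt0 //; lra.
have e3 : (n%:R^-1 <= 2 / n.+1%:R :> R).
  by rewrite ler_pdivlMr // mulrC ler_pdivrMr // XE; lra.
have e4 : n%:R^-1 - n.+1%:R^-1 <= 2 / n.+1%:R ^+ 2 :> R.
  have -> : n%:R^-1 - n.+1%:R^-1 = n%:R^-1 / n.+1%:R :> R.
    by rewrite XE; field; rewrite -XE !lt0r_neq0.
  by rewrite expr2 invfM mulrA ler_pM2r // invr_gt0.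
have [y yE] : exists y : R, y = n.+1%:R^-1 by exists (n.+1%:R^-1).
have y0 : 0 < y by rewrite yE invr_gt0.
have yM : 4 * M * y <= 1 by rewrite yE ler_pdivrMr // mul1r.
have {}e3 : L - l <= 2 * y by apply: le_trans e2 _; rewrite yE.
have {}e4 : L - l <= y + 2 * y ^+ 2.
  by apply: le_trans e2 _; move: e4; rewrite -exprVn -yE lerBlDr addrC.
have {e2}e1 : l - L <= - y by rewrite yE.
have cv : cn v <= M * (2 * y).
  rewrite /v cnM cn_real; apply: ler_pM => //; first exact: cn_ge0.
  by rewrite -/l -/L ler0_norm; lra.
have cv2 : cn v <= 1 / 2.
  by apply: le_trans cv _; move: yM; clear; lra.
(* [16 * M ^+ 2] is [4 * (2 * M) ^+ 2], from the quadratic remainder of [cexp v]; [2 * M] comes from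
   replacing [L - l] by [y]. *)
have bracket : cn (1 - cexp v + (s - 1) / n.+1%:R) <= (16 * M ^+ 2 + 2 * M) * y ^+ 2.
  have -> : 1 - cexp v + (s - 1) / n.+1%:R =
     - (cexp v - 1 - v) - (1 - s) * (l - L + y)%:C.
    rewrite (rmorphD _ (l - L)) yE /= fmorphV rmorph_nat mulrDr -/v; ring.
  apply: le_trans (cnB _ _) _; rewrite cnN cnM cn_real.
  have h1 := cexp_quadratic cv2.
  have h2 : cn v ^+ 2 <= (M * (2 * y)) ^+ 2.
    by rewrite lerXn2r ?nnegrE ?cn_ge0 // (le_trans (cn_ge0 v)).
  have h3 : cn (1 - s) * `|l - L + y| <= M * (2 * y ^+ 2).
    by apply: ler_pM => //; [exact: cn_ge0 | rewrite ler0_norm; lra].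
  lra.
(* The modulus of [(n + 1) ^ (1 - s)] depends on [Re s] only, and [Re s >= 1/2]. *)
have front : cn (cexp ((1 - s) * L%:C)) <= Num.sqrt n.+1%:R.
  rewrite cn_cexp.
  have -> : complex.Re ((1 - s) * L%:C : R[i]) = (1 - complex.Re (s : R[i])) * L.
    by case: (s) => a b /=; rewrite mulr0 subr0.
  have -> : Num.sqrt n.+1%:R = expR (2^-1 * L).
    apply/eqP; rewrite -(@eqrXn2 _ 2) ?sqrtr_ge0 ?expR_ge0 // sqr_sqrtr ?ltW //.
    by rewrite -expRM_natr mulrAC mulVf // mul1r lnK ?posrE.
  rewrite ler_expR ler_wpM2r; [by [] | by rewrite ln_ge0 // XE; lra | lra].
rewrite cnM; apply: le_trans (ler_pM (cn_ge0 _) (cn_ge0 _) front bracket) _.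
set K := 16 * _ + _; have K0 : 0 <= K by rewrite addr_ge0 ?mulr_ge0 // sqr_ge0.
rewrite mulrCA [2 * K]mulrC -mulrA yE exprVn; apply: ler_wpM2l => //.
exact: inv_sqrtS_le.
Qed.

Lemma zeta_partial_cauchy M s n m : (0 < n)%N -> 4 * M <= n%:R ->
  2^-1 <= complex.Re (s : R[i]) -> cn (1 - s) <= M -> (n <= m)%N ->
  cn (zeta_partial m s - zeta_partial n s) <=
  2 * (16 * M ^+ 2 + 2 * M) / Num.sqrt (n%:R : R).
Proof.
move=> n0 nM hs sM nm; have M0 : 0 <= M := le_trans (cn_ge0 _) sM.
set K := 2 * _; have K0 : 0 <= K by rewrite mulr_ge0 // addr_ge0 ?mulr_ge0 // sqr_ge0.
suff : cn (zeta_partial m s - zeta_partial n s) <=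
    K * ((Num.sqrt (n%:R : R))^-1 - (Num.sqrt (m%:R : R))^-1).
  move=> /le_trans; apply; apply: ler_wpM2l => //.
  by rewrite lerBlDr lerDl invr_ge0 sqrtr_ge0.
elim: m nm => [|m IH]; first by rewrite leqn0 => /eqP ->; rewrite !subrr mulr0 cn0.
rewrite leq_eqVlt => /orP [/eqP <-|]; first by rewrite !subrr mulr0 cn0.
rewrite ltnS => nm; apply: le_trans (cn_tri _ (zeta_partial m s) _) _.
have m0 : (0 < m)%N by exact: leq_trans nm.
have mM : 4 * M <= m.+1%:R by apply: le_trans nM _; rewrite ler_nat ltnW.
have := zeta_partial_step m0 mM hs sM; have := IH nm; rewrite -/K.
set a := cn _; set b := cn _; lra.
Qed.

Lemma zeta_partial_small (K M e : R) : 0 < e ->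
  exists n : nat, [/\ (0 < n)%N, 4 * M <= n%:R & K / Num.sqrt (n%:R : R) <= e].
Proof.
move=> e0; pose A := 4 * `|M| + (K / e) ^+ 2.
have A1 : 0 <= 4 * `|M| by rewrite mulr_ge0.
have A2 := sqr_ge0 (K / e).
pose n := (Num.truncn A).+1; have An : A < n%:R by exact: truncnS_gt.
have n0 : 0 < n%:R :> R by rewrite ltr0n.
exists n; split=> //; first by have := ler_norm M; rewrite /A in An; lra.
have s0 : 0 < Num.sqrt (n%:R : R) by rewrite sqrtr_gt0.
rewrite ler_pdivrMr // -ler_pdivrMl // mulrC.
apply: le_trans (ler_norm _) _; rewrite -sqrtr_sqr ler_sqrt; last exact: ltW.
rewrite /A in An; lra.
Qed.

Lemma zeta_partial1 n : zeta_partial n 1 = 1.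
Proof. by rewrite /zeta_partial subrr mul0r add0r cpowE mul0r cexp0. Qed.

(** Away from 1, the sequence under the limit in [zeta] is [zeta_partial n s / (s - 1)], which
    converges by the Cauchy bound; at 1 both sides equal 1. *)
Lemma zetak_reg1_lim s : 2^-1 <= complex.Re (s : R[i]) -> forall e : R, 0 < e ->
  exists N, forall n, (N <= n)%N -> cn (zeta_partial n s - zetak_reg 1 s) <= e.
Proof.
move=> hs; rewrite /zetak_reg; have [->|s1] := eqVneq s 1.
  by move=> e e0; exists 0%N => n _; rewrite zeta_partial1 subrr cn0 ltW.
have [|l Hl] := @cauchy_cn R (zeta_partial^~ s).
  move=> e e0; pose M := cn (1 - s).
  have [n [n0 nM ne]] := zeta_partial_small (2 * (16 * M ^+ 2 + 2 * M)) M e0.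
  exists n => m nm; apply: le_trans ne; exact: zeta_partial_cauchy.
have s1' : s - 1 != 0 by rewrite subr_eq0.
suff -> : zeta s = l / (s - 1) by rewrite expr1 mulrC mulfVK.
apply: cvg_lim; first exact: norm_hausdorff.
apply: cvg_cn => e e0; have c0 := cn_gt0 s1'.
have [N HN] := Hl _ (mulr_gt0 e0 c0).
exists N => n /HN; rewrite -ler_pdivrMr // -cnV -cnM; congr (cn _ <= _).
rewrite /zeta_partial; set S := \sum_(_ <= _ < _) _; field.
by rewrite s1' -opprB oppr_eq0.
Qed.

Lemma zetak_reg1_unif M (e : R) : 0 < e -> exists n, forall s,
  2^-1 <= complex.Re (s : R[i]) -> cn (1 - s) <= M ->
  cn (zeta_partial n s - zetak_reg 1 s) <= e.
Proof.
move=> e0; have e2 : 0 < e / 2 by lra.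
have [n [n0 nM ne]] := zeta_partial_small (2 * (16 * M ^+ 2 + 2 * M)) M e2.
(* [N] depends on [s] but [n] does not: the Cauchy bound links [n] to [maxn n N] uniformly. *)
exists n => s hs sM; have [N HN] := zetak_reg1_lim hs e2.
have := cn_tri (zeta_partial n s) (zeta_partial (maxn n N) s) (zetak_reg 1 s).
have := HN _ (leq_maxr n N).
have := le_trans (zeta_partial_cauchy n0 nM hs sM (leq_maxl n N)) ne.
rewrite (cnC (zeta_partial n s) (zeta_partial _ s)); lra.
Qed.

Lemma poly_approx_zeta_partial (g : C R -> C R) r n : poly_approx (disc r) g ->
  poly_approx (disc r) (fun z => zeta_partial n (g z)).
Proof.
move=> Hg.
have affine (a b : C R) : poly_approx (disc r) (fun z => a + b * g z).
  apply: poly_approxD; first exact: poly_approx_cst.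
  by apply: poly_approxM => //; exact: poly_approx_cst.
have cexp_affine (a b c : C R) :
    poly_approx (disc r) (fun z => cexp ((a + b * g z) * c)).
  have Hac := poly_approxM (affine a b) (@poly_approx_cst R (disc r) c).
  have [B _ HB] := poly_approx_bounded Hac.
  exact: (poly_approx_comp (@poly_approx_cexp R B) Hac HB).
apply: poly_approxD; last first.
  apply: poly_approx_ext (cexp_affine 1 (-1) (ln (n%:R : R))%:C) => z _.
  by rewrite cpowE mulN1r.
apply: poly_approxM.
  by apply: poly_approx_ext (affine (-1) 1) => z _; rewrite mul1r addrC.
apply: poly_approx_sum => i.
apply: poly_approx_ext (cexp_affine 0 (-1) (ln (i%:R : R))%:C) => z _.
by rewrite cpowE add0r mulN1r.
Qed.

Lemma poly_approx_zetak_reg k (g : C R -> C R) r : poly_approx (disc r) g ->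
  (forall z, disc r z -> 2^-1 <= complex.Re (g z : R[i])) ->
  poly_approx (disc r) (fun z => zetak_reg k (g z)).
Proof.
move=> Hg g2.
have H1 : poly_approx (disc r) (fun z => zetak_reg 1 (g z)).
  have [B B0 HB] := poly_approx_bounded Hg.
  apply: poly_approx_unif => e e0; have [n Hn] := zetak_reg1_unif (1 + B) e0.
  exists (fun z => zeta_partial n (g z)); first exact: poly_approx_zeta_partial.
  move=> z zr; apply: Hn; first exact: g2.
  by apply: le_trans (cnB _ _) _; rewrite cn1 lerD2l; exact: HB.
apply: poly_approx_ext (poly_approxX k H1) => z _.
by rewrite /zetak_reg; case: eqP => _; rewrite ?expr1n ?expr1.
Qed.

End ZetaApproximation.


(** * Power series under the substitution [t = z / (1 - z)] *)

Section ChangeOfVariable.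
Variable R : realType.
Implicit Types (f g : C R -> C R).

Lemma powser_ext (rho : R) f g a b : (forall z, cn z < rho -> f z = g z) -> a =1 b ->
  powser rho f a -> powser rho g b.
Proof.
move=> fg ab Hf r d r0 rr d0; have [p Hp pa] := Hf r d r0 rr d0.
exists p => [z zr|n]; last by rewrite -ab.
by rewrite -fg; [exact: Hp | exact: le_lt_trans rr].
Qed.

Lemma powser_poly (rho : R) (p : {poly C R}) : powser rho (horner p) (fun n => p`_n).
Proof.
move=> r d _ _ d0; exists p => [z _|n]; first by rewrite subrr cn0 ltW.
by rewrite subrr cn0 mul0r ltW.
Qed.

(** This is [(1 - z) ^+ k * t ^+ j] with [t = z / (1 - z)]; the separate inverse covers [j > k]
    without negative exponents. *)
Definition mobius_mono k j : C R -> C R := fun z => z ^+ j * (1 - z) ^+ k * (1 - z)^-1 ^+ j.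

(* The coefficient of [z ^+ m] in [z ^+ j * (1 - z) ^ (k - j)], by the binomial
   or the negative binomial series according to the sign of [k - j]. *)
Definition mobius_coef k j m : C R :=
  if (m < j)%N then 0
  else if (j <= k)%N then (-1) ^+ (m - j) * 'C(k - j, m - j)%:R
  else 'C(m - k.+1, j - k.+1)%:R.

(** Pascal's rule, in the form of the identity [z * f j = (1 - z) * f j.+1] between the functions
    [f j = mobius_mono k j]. At [j = k] it joins the two binomial formulas. *)
Lemma mobius_coefS k j m :
  mobius_coef k j.+1 m.+1 = mobius_coef k j.+1 m + mobius_coef k j m.
Proof.
rewrite /mobius_coef ltnS subSS; case: ltngtP => [mj|jm|<-].
- by rewrite (ltn_trans mj) // add0r.
- have [jk|kj|<-] := ltngtP j k.
  + rewrite ltnNge jm /=.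
    have -> : (k - j = (k - j.+1).+1)%N by lia.
    have -> : (m - j = (m - j.+1).+1)%N by lia.
    by rewrite binS natrD exprS; ring.
  + rewrite ltnNge jm /= !subSS.
    have -> : (m - k = (m - k.+1).+1)%N by lia.
    have -> : (j - k = (j - k.+1).+1)%N by lia.
    by rewrite binS natrD.
  + rewrite ltnNge jm /= subnn !bin0 bin_small ?mulr0 ?addr0 //; lia.
- rewrite ltnSn add0r !subnn !bin0 expr0 mulr1 subSS.
  have [jk|kj|<-] := ltngtP m k; rewrite ?bin0 ?mulr1 ?subnn ?bin0 //.
  by rewrite !binn.
Qed.

Lemma analytic_mobius_mono k j : analytic_on 1 (mobius_mono k j).
Proof.
move=> r r1; apply: poly_approxM; last exact/poly_approxX/poly_approx_geometric.
apply: poly_approxM; first exact/poly_approxX/poly_approx_id.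
apply: poly_approxX.
apply: poly_approx_ext (@poly_approx_poly R (disc r) (1 - 'X)) => z _.
by rewrite !hornerE.
Qed.

Lemma subr1_neq0 (z : C R) : cn z < 1 -> 1 - z != 0.
Proof. by apply: contraTneq => /subr0_eq <-; rewrite cn1 ltxx. Qed.

Lemma coef_expr_1BX k m : ((1 - 'X : {poly C R}) ^+ k)`_m = (-1) ^+ m * 'C(k, m)%:R.
Proof.
elim: k m => [|k IH] m.
  by rewrite expr0 coef1 bin0n; case: m => [|m]; rewrite /= ?expr0 ?mulr1 ?mulr0.
rewrite exprS mulrBl mul1r coefB coefXM !IH; case: m => [|m] /=.
  by rewrite !bin0 subr0.
by rewrite binS natrD exprS; ring.
Qed.

(** Analyticity provides some coefficients [b] for [j.+1]; uniqueness applied to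
    [z * f j = f j.+1 - z * f j.+1] yields the recurrence of [mobius_coefS], which determines
    them. *)
Lemma powser_mobius_mono k j : powser 1 (mobius_mono k j) (mobius_coef k j).
Proof.
elim: j => [|j IH].
  apply: powser_ext (@powser_poly 1 ((1 - 'X) ^+ k)) => [z _|m].
    by rewrite /mobius_mono !expr0 mul1r mulr1 horner_exp !hornerE.
  by rewrite /mobius_coef ltn0 leq0n !subn0 coef_expr_1BX.
have [b Hb] := powser_exists (@analytic_mobius_mono k j.+1).
apply: powser_ext (Hb) => // m.
have E := powser_uniq (r := 2^-1) (powserMX IH) (powserD Hb (powserZ (-1) (powserMX Hb))).
have {}E := E ltac:(lra) ltac:(lra) ltac:(lra).
have {E}E n : (if n is m.+1 then mobius_coef k j m else 0) =
    b n + -1 * (if n is m.+1 then b m else 0).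
  apply: E => z zr; have z1 : 1 - z != 0.
    by apply: subr1_neq0; apply: le_lt_trans zr _; lra.
  by rewrite /mobius_mono !exprS; field.
elim: m => [|m IHm]; first by have := E 0%N; rewrite mulr0 addr0 => <-; rewrite /mobius_coef.
by rewrite mobius_coefS -IHm (E m.+1); ring.
Qed.

(* In the variable [z = t / (1 + t)], where [1 + t = (1 - z)^-1]. *)
Lemma powser_mobius k f c b : powser (1 / 2) f c ->
  powser 1 (fun z => (1 - z) ^+ k * f ((1 - z)^-1 - 1)) b ->
  forall m, b m = \sum_(i < m.+1) c i * mobius_coef k i m.
Proof.
move=> Hf Hg m; apply/eqP; rewrite -subr_eq0; apply/eqP/cn_eq0/eqP.
rewrite eq_le cn_ge0 andbT.
pose r : R := 1 / 4; have rm : 0 < r ^+ m by rewrite exprn_gt0 // /r; lra.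
rewrite -(ler_pM2r rm) mul0r; apply: (@le_of_le_addM _ (2 ^+ k)) => e e0 _; rewrite add0r.
(* For [cn z <= 1 / 4], [t = z / (1 - z)] has modulus at most [(1 / 4) / (3 / 4) = 1 / 3], inside
   the disc of radius [1 / 2]. *)
have [N HN] := powser_cvg_unif (t := 1 / 3) Hf ltac:(lra) ltac:(lra) e0.
pose n := maxn N m.+1.
have -> : \sum_(i < m.+1) c i * mobius_coef k i m = \sum_(i < n) c i * mobius_coef k i m.
  rewrite -!(big_mkord xpredT (fun i => c i * mobius_coef k i m)).
  rewrite [RHS](big_cat_nat (n := m.+1)) ?leq_maxr //= [X in _ = _ + X]big_nat_cond.
  rewrite [X in _ = _ + X]big1 ?addr0 // => i /andP [/andP [mi _] _].
  by rewrite /mobius_coef mi mulr0.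
have Hs := powser_sum n (fun i => powserZ (c i) (powser_mobius_mono k i)).
rewrite /=; apply: (powser_le m Hg Hs); rewrite /r; try lra.
move=> z; rewrite /disc => zr.
have z1 : 1 - z != 0 by apply: subr1_neq0; lra.
have cz : 3 / 4 <= cn (1 - z) by have := cnD (1 - z) z; rewrite subrK cn1; lra.
have cz2 : cn (1 - z) <= 2 by have := cnB 1 z; rewrite cn1; lra.
have tE : (1 - z)^-1 - 1 = z / (1 - z) by field.
have ct : disc (1 / 3) ((1 - z)^-1 - 1).
  by rewrite /disc tE cnM cnV ler_pdivrMr; lra.
have -> : \sum_(i < n) c i * mobius_mono k i z =
    (1 - z) ^+ k * \sum_(i < n) c i * ((1 - z)^-1 - 1) ^+ i.
  rewrite mulr_sumr; apply: eq_bigr => i _; rewrite tE exprMn /mobius_mono; ring.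
rewrite -mulrBr cnM cnX; apply: ler_pM; rewrite ?exprn_ge0 ?cn_ge0 //.
  by rewrite lerXn2r ?nnegrE ?cn_ge0.
by rewrite cnC; apply: HN => //; exact: leq_maxl.
Qed.

End ChangeOfVariable.


(** * Expansion of the powers of zeta in [(s - 1) / s] *)

Section ZetaPowers.
Variable R : realType.

(** With [z = x + iy], the claim [2 * (1 - x) >= (1 - x) ^+ 2 + y ^+ 2] reduces to
    [x ^+ 2 + y ^+ 2 <= 1]. *)
Lemma Re_inv1B_ge (z : C R) : cn z < 1 -> 2^-1 <= complex.Re ((1 - z)^-1 : R[i]).
Proof.
move=> z1; have h : cn z ^+ 2 < 1 by rewrite expr_lt1 ?cn_ge0.
have c0 := cn_gt0 (subr1_neq0 z1).
have : 0 < cn (1 - z) ^+ 2 by rewrite exprn_gt0.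
move: h; rewrite !cn_sqr; case: z {z1 c0} => x y /=; rewrite sub0r sqrrN => h p.
rewrite ler_pdivlMr //; lra.
Qed.

(** The radius [1 / 2] keeps [1 + t] in the half-plane [Re >= 1/2]. *)
Lemma analytic_zetak_reg_add1 k : analytic_on (1 / 2) (fun t : C R => zetak_reg k (1 + t)).
Proof.
move=> r r2; apply: (poly_approx_zetak_reg k (g := fun t => 1 + t)).
  by apply: poly_approxD; [exact: poly_approx_cst | exact: poly_approx_id].
move=> t tr; rewrite raddfD /=; have := Re_le_cn t; have := ler_norm (- complex.Re (t : R[i])).
rewrite normrN; move: tr; rewrite /disc; lra.
Qed.

Lemma analytic_zetak_reg_inv1B k :
  analytic_on 1 (fun z : C R => (1 - z) ^+ k * zetak_reg k ((1 - z)^-1)).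
Proof.
move=> r r1; apply: poly_approxM.
  apply: poly_approxX.
  apply: poly_approx_ext (@poly_approx_poly R (disc r) (1 - 'X)) => z _.
  by rewrite !hornerE.
apply: (poly_approx_zetak_reg k (g := fun z => (1 - z)^-1)).
  exact: poly_approx_geometric.
by move=> z zr; apply: Re_inv1B_ge; exact: le_lt_trans r1.
Qed.

Lemma powser_lambda k :
  powser (1 / 2) (fun t : C R => zetak_reg k (1 + t)) (fun j => lambda R j k / j`!%:R).
Proof.
have Hf := analytic_zetak_reg_add1 k; have [T HT] := taylor_coef_exists Hf.
apply: powser_ext (taylor_powser Hf HT) => // j.
have -> : lambda R j k = j`!%:R * T j 0.
  rewrite /lambda -[X in derive1n _ _ X]addr0.
  by apply: (derive1n_taylor j Hf HT) => //; rewrite cn0; lra.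
by rewrite mulrC mulKf // pnatr_eq0 -lt0n fact_gt0.
Qed.

(** For [m <= k] the symmetry of binomials turns [m - i] into [k - m]. For [m > k] the terms with
    [i <= k] vanish, and [i = j + k] reindexes the others. *)
Lemma ell_mobius k m :
  (-1) ^ (m%:Z - k%:Z) * ell R (m%:Z - k%:Z) k =
  \sum_(i < m.+1) lambda R i k / i`!%:R * mobius_coef R k i m.
Proof.
rewrite -(big_mkord xpredT (fun i => lambda R i k / i`!%:R * mobius_coef R k i m)).
have [mk|km] := leqP m k.
  have -> : m%:Z - k%:Z = - (k - m)%:Z by rewrite -subzn // opprB.
  rewrite /ell oppr_gt0 ltNge /= abszN /= subKn // mulrA.
  have -> : (-1) ^ (- (k - m)%:Z) * (-1) ^+ k = (-1) ^+ m :> C R.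
    by rewrite -invr_expz -exprnP -{2}(subnK mk) exprD mulKf // signr_eq0.
  rewrite mulr_sumr; apply: eq_big_nat => i /andP [_]; rewrite ltnS => im.
  rewrite /mobius_coef ltnNge im /= (leq_trans im mk).
  rewrite -bin_sub; last by lia.
  have -> : (k - i - (k - m) = m - i)%N by lia.
  have -> : (-1) ^+ m = (-1) ^+ (m - i) * (-1) ^+ i :> C R by rewrite -exprD subnK.
  set e := (-1) ^+ i; have ee : e * e = 1 by rewrite -expr2 sqrr_sign.
  by rewrite -[RHS]mul1r -[X in _ = X * _]ee; ring.
have -> : m%:Z - k%:Z = (m - k)%:Z by rewrite subzn // ltnW.
have -> : ell R (m - k)%:Z k = (-1) ^+ (m - k) *
    \sum_(1 <= j < (m - k).+1) 'C((m - k).-1, j.-1)%:R * lambda R (j + k) k / (j + k)`!%:R.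
  by rewrite /ell ltz_nat subn_gt0 km.
rewrite -exprnP mulrA -expr2 sqrr_sign mul1r.
rewrite [RHS](big_cat_nat (n := k.+1)) ?ltnS ?(ltnW km) //= [X in _ = X + _]big_nat_cond.
rewrite [X in _ = X + _]big1 ?add0r => [|i /andP [/andP [_ ik] _]]; last first.
  rewrite ltnS in ik; rewrite /mobius_coef ltnNge (leq_trans ik (ltnW km)) /= ik.
  by rewrite bin_small ?mulr0 //; lia.
rewrite -[k.+1]add1n big_addn subSn 1?ltnW //; apply: eq_big_nat => j /andP [j1 jm].
rewrite /mobius_coef ifF; last by apply/negbTE; rewrite -leqNgt; lia.
rewrite ifF; last by apply/negbTE; rewrite -ltnNge; lia.
have -> : (m - k.+1 = (m - k).-1)%N by lia.
have -> : (j + k - k.+1 = j.-1)%N by lia.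
by rewrite [RHS]mulrC mulrA.
Qed.

(** Coefficients exist on the whole unit disc by analyticity there; they are identified near 0,
    where the Taylor expansion at [s = 1] is available. *)
Lemma powser_ell k :
  powser 1 (fun z : C R => (1 - z) ^+ k * zetak_reg k ((1 - z)^-1))
    (fun m => (-1) ^ (m%:Z - k%:Z) * ell R (m%:Z - k%:Z) k).
Proof.
have [b Hb] := powser_exists (@analytic_zetak_reg_inv1B k).
apply: powser_ext (Hb) => // m; rewrite ell_mobius.
apply: (powser_mobius (powser_lambda k)).
by apply: powser_ext Hb => // z _; rewrite [1 + (_ - 1)]addrC subrK.
Qed.

Lemma cvg_series_norm (u : nat -> C R) :
  cvgn (series (fun m => cn (u m))) -> cvgn (series (fun m => `|u m|)).
Proof.
move=> cu; pose l := limn (series (fun m => cn (u m))).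
apply/cvg_ex; exists (l%:C : C R); apply: cvg_cn => e e0.
have /cvgrPdist_le /(_ e e0) [N _ HN] := cu.
exists N => n /HN; rewrite /= distrC -/l -cn_real; congr (cn _ <= _).
by rewrite rmorphB /series /= rmorph_sum.
Qed.

Lemma cn_sub1_lt (s : C R) : 2^-1 < complex.Re (s : R[i]) -> cn (s - 1) < cn s.
Proof.
move=> hs; rewrite -(@ltr_pXn2r _ 2) ?nnegrE ?cn_ge0 // !cn_sqr.
by case: s hs => x y /= hs; rewrite oppr0 addr0; nra.
Qed.

End ZetaPowers.

Unset Implicit Arguments.

(* The series over n >= -k is indexed by m : nat with n = m - k. *)
Theorem theorem1 (R : realType) (k : nat) (hk : (0 < k)%N) (s : C R)
  (hs1 : s != 1) (hs : (2^-1 : R) < complex.Re (s : R[i])) :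
  let w : C R := (s - 1) / s in
  let u : nat -> C R := fun m =>
    let n : int := (m%:Z - k%:Z)%R in (-1) ^ n * ell R n k * w ^ n in
  cvgn (series (fun m => `|u m|)) /\ zeta s ^+ k = limn (series u).
Proof.
move=> w u; have s1 := cn_sub1_lt hs.
have s0 : s != 0 by apply: contraTneq s1 => ->; rewrite cn0 -leNgt cn_ge0.
have s1' : s - 1 != 0 by rewrite subr_eq0.
have w0 : w != 0 by rewrite mulf_neq0 ?invr_eq0.
have w1 : cn w < 1 by rewrite cnM cnV ltr_pdivrMr ?mul1r ?cn_gt0.
(* The constant factor [w ^- k] turns [w ^+ m] into the power of exponent [m - k]. *)
have H := powserZ (w ^- k) (powser_ell (R := R) k).
have uE : u = fun m => w ^- k * ((-1) ^ (m%:Z - k%:Z) * ell R (m%:Z - k%:Z) k) * w ^+ m.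
  by apply/funext => m; rewrite /u (expfzDr _ _ w0) -invr_expz -!exprnP; ring.
split; first by apply: cvg_series_norm; rewrite uE; exact: powser_abs_cvg H w1.
have := powser_cvg H w1; rewrite -uE.
(* Since [1 - w = s^-1], the factor in front is [(s - 1) ^- k], which cancels the one in
   [zetak_reg k s]. *)
have -> : w ^- k * ((1 - w) ^+ k * zetak_reg k (1 - w)^-1) = zeta s ^+ k.
  have -> : 1 - w = s^-1 by rewrite /w; field.
  rewrite invrK /zetak_reg (negbTE hs1) exprMn /w exprMn !exprVn; field.
  by rewrite !expf_neq0.
by move/cvg_lim => -> //; exact: norm_hausdorff.
Qed.
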